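(* Let $f(z) = z + a_2 z^2 + a_3 z^3 + \cdots$ belong to $\mathcal{S}_e^{\ast}$, and let $\gamma_1,\gamma_2,\gamma_3,\gamma_4$ be its first four logarithmic coefficients. Then $$|\gamma_n| \le \frac{1}{2n} \quad \text{for } n = 1,2,3,4.$$ All these bounds are sharp, i.e. for each $n\in\{1,2,3,4\}$ there is a function in $\mathcal{S}_e^{\ast}$ for which equality holds.
   Context: $\mathbb{D}=\{z\in\mathbb{C}:|z|<1\}$. $\mathcal{S}$ is the class of univalent analytic functions $f$ on $\mathbb{D}$ with $f(0)=0$, $f'(0)=1$, written $f(z)=z+\sum_{n\ge2}a_nz^n$. For analytic $g,h$ on $\mathbb{D}$, $g\prec h$ (subordination) means that there is an analytic $\omega:\mathbb{D}\to\mathbb{D}$ with $\omega(0)=0$ and $g(z)=h(\omega(z))$ for $z\in\mathbb{D}$. The class $\mathcal{S}_e^{\ast}$ is $$\mathcal{S}_e^{\ast}=\left\{f\in\mathcal{S}:\ \frac{zf'(z)}{f(z)}\prec e^z,\ z\in\mathbb{D}\right\}.$$ The logarithmic coefficients $\gamma_n$ of $f\in\mathcal{S}$ are defined by $\log\frac{f(z)}{z}=2\sum_{n=1}^\infty\gamma_nz^n$, $z\in\mathbb{D}$, with $\log 1=0$. Explicitly, $\gamma_1=\frac12a_2$, $\gamma_2=\frac12\left(a_3-\frac12a_2^2\right)$, $\gamma_3=\frac12\left(a_4-a_2a_3+\frac13a_2^3\right)$, $\gamma_4=\frac12\left(a_5-a_2a_4+a_2^2a_3-\frac12a_3^2-\frac14a_2^4\right)$.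 *)

(* Defs.v *)
From Stdlib Require Export Reals.
From Coquelicot Require Export Coquelicot.

Local Open Scope C_scope.

(* A function on the unit disk is represented by a total function C -> C.
   Everything below depends only on its restriction to the disk, which is
   open, so complex derivatives at its points are unaffected by junk values. *)
Definition unit_disk (z : C) : Prop := (Cmod z < 1)%R.

Definition Cexp (z : C) : C :=
  RtoC (exp (Re z)) * (cos (Im z), sin (Im z)).

(* The normed-module structure is made explicit so that differentiability is
   complex (over [C_AbsRing]) and matches the one used by [C_derive]. *)
Definition analytic_on_disk (f : C -> C) : Prop :=
  forall z, unit_disk z -> ex_derive (K := C_AbsRing) (V := C_NormedModule) f z.

Definition univalent_on_disk (f : C -> C) : Prop :=
  forall z w, unit_disk z -> unit_disk w -> f z = f w -> z = w.

Definition class_S (f : C -> C) : Prop :=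
  analytic_on_disk f /\ univalent_on_disk f /\
  f 0 = 0 /\ C_derive f 0 = 1.

Definition subordinate (g h : C -> C) : Prop :=
  exists w : C -> C,
    analytic_on_disk w /\
    (forall z, unit_disk z -> unit_disk (w z)) /\
    w 0 = 0 /\
    (forall z, unit_disk z -> g z = h (w z)).

(* z f'(z) / f(z) and f(z) / z have a removable singularity at 0 when f is in
   the class S, with value f'(0) = 1 there; division by zero in [C] would give
   a different value. *)
Definition zderiv_quot (f : C -> C) (z : C) : C :=
  if Ceq_dec z 0 then 1 else z * C_derive f z / f z.

Definition quot_id (f : C -> C) (z : C) : C :=
  if Ceq_dec z 0 then 1 else f z / z.

Definition class_S_e_star (f : C -> C) : Prop :=
  class_S f /\ subordinate (zderiv_quot f) Cexp.

(* The analytic branch of log (f(z) / z) on the disk normalised by log 1 = 0. *)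
Definition is_log_quot (f L : C -> C) : Prop :=
  analytic_on_disk L /\ L 0 = 0 /\
  (forall z, unit_disk z -> Cexp (L z) = quot_id f z).

(* [gamma n] is the n-th logarithmic coefficient for n >= 1; [gamma 0] is
   unconstrained. *)
Definition is_log_coeffs (f : C -> C) (gamma : nat -> C) : Prop :=
  exists L : C -> C, is_log_quot f L /\
    forall z, unit_disk z ->
      exists s : C,
        is_series (K := C_AbsRing) (V := C_NormedModule)
          (fun k : nat => gamma (S k) * z ^ (S k)) s /\
        L z = 2 * s.

(* Main.v *)
Require Import Defs.
From Stdlib Require Import Lra Lia Psatz Factorial.

(** Write [L] for the branch of log (f(z)/z), so that f = z exp(L) and
    z f'/f = 1 + z L'.  The n-th Taylor coefficient of 1 + z L' is 2 n gamma_n, so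
    the claim is that a power series 1 + p_1 z + p_2 z^2 + ... subordinate to the
    exponential satisfies |p_n| <= 1.  This holds for every n >= 1, for the reason
    found by Rogosinski: the image of the disk under exp is convex.

    Let P be the series and omega a primitive n-th root of unity.  The average
    G(z) of the values P(omega^k z) is again a power series, 1 + p_n z^n + ...,
    because averaging kills the exponents which n does not divide.  Each P(omega^k z) is
    the exponential of a point of the disk, so by convexity G(z) is one too
    ([exp_disk_convex]).  Hence log G maps the disk to itself and has a zero of
    order n with leading coefficient p_n, and the Schwarz lemma gives |p_n| <= 1
    ([Schwarz_order], [coeff_bound_of_exp_subordinate]).

    Three classical facts are proved on the way by elementary means.
    - A convergent complex power series is differentiable term by term
      ([disk_series_derive]).  Applied repeatedly it shows that the functions above
      have continuous derivatives.
    - The circle mean of a function holomorphic in the punctured disk does not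
      depend on the radius: its radial derivative is the integral of an angular
      derivative ([circle_mean_const]).  For log G / z^n, comparing radii near 0 and
      near 1 yields the Schwarz lemma.
    - At a boundary point exp(zeta) the image of the disk lies strictly on one side
      of its tangent ([exp_disk_support]), while exp(rho zeta) with rho >= 1 does not
      ([exp_ray_support]).  So an average of points of the image cannot be
      of the form exp(rho zeta).

    For sharpness take f = z exp(L) with z L' = exp(z^n) - 1, that is,
    L = sum over j >= 1 of z^(n j) / (n j j!), so that gamma_n = 1/(2n).  The one
    nontrivial membership condition is univalence.  In the coordinate z = exp(u) on
    the half plane Re u < 0, log f becomes u + L(exp u), whose derivative exp(z^n)
    has positive real part, and such a function is injective on a convex domain
    ([starlike_univalent]). *)

Local Open Scope C_scope.

(** * Complex derivatives *)

(** The epsilon-delta form of complex differentiability.  The library has two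
    normed-module structures on [C] over itself: the calculus rules are available
    for one, and the definition of an analytic function uses the other.  Both
    notions of derivative are equivalent to this one. *)
Definition cderiv (f : C -> C) (z l : C) : Prop :=
  forall eps : R, (0 < eps)%R -> exists delta : R, (0 < delta)%R /\
    forall w, (Cmod (w - z) < delta)%R ->
      (Cmod (f w - f z - l * (w - z)) <= eps * Cmod (w - z))%R.

Lemma cderiv_abs f z l :
  cderiv f z l <->
  is_derive (K := C_AbsRing) (V := AbsRing_NormedModule C_AbsRing) f z l.
Proof.
split.
- intros H; split.
  + apply (is_linear_scal_l (K := C_AbsRing) (V := AbsRing_NormedModule C_AbsRing)).
  + intros x Hx.
    assert (Hxz : z = x) by exact (is_filter_lim_locally_unique (K := C_AbsRing) (V := AbsRing_NormedModule C_AbsRing) _ _ Hx).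
    subst x. intros eps.
    destruct (H eps (cond_pos eps)) as [d [Hd Hw]].
    exists (mkposreal d Hd). intros w Hb.
    change (Cmod ((f w - f z) - (w - z) * l) <= eps * Cmod (w - z))%R.
    replace ((f w - f z) - (w - z) * l) with (f w - f z - l * (w - z)) by ring.
    exact (Hw w Hb).
- intros [_ H] eps Heps.
  assert (Hl : is_filter_lim (locally (T := AbsRing_NormedModule C_AbsRing) z) z)
    by (intros P HP; exact HP).
  specialize (H z Hl (mkposreal eps Heps)).
  destruct H as [d Hd].
  exists d; split; [apply cond_pos|].
  intros w Hw. specialize (Hd w Hw). simpl in Hd.
  replace (f w - f z - l * (w - z)) with ((f w - f z) - (w - z) * l) by ring.
  exact Hd.
Qed.

Lemma cderiv_is_derive f z l :
  cderiv f z l <-> is_derive (K := C_AbsRing) (V := C_NormedModule) f z l.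
Proof.
rewrite cderiv_abs; split; intros [[Lp Ls Ln] H].
- split; [exact (Build_is_linear (U := AbsRing_NormedModule C_AbsRing) (V := C_NormedModule) _ Lp Ls Ln) | exact H].
- split; [exact (Build_is_linear (U := AbsRing_NormedModule C_AbsRing) (V := AbsRing_NormedModule C_AbsRing) _ Lp Ls Ln) | exact H].
Qed.

Lemma cderiv_ext f g z l r : (0 < r)%R ->
  (forall w, (Cmod (w - z) < r)%R -> f w = g w) -> cderiv f z l -> cderiv g z l.
Proof.
intros Hr He H eps Heps. destruct (H eps Heps) as [d [Hd Hw]].
exists (Rmin d r); split; [apply Rmin_pos; assumption|].
intros w Hwd.
assert (Hz : f z = g z).
{ apply He. replace (z - z) with (RtoC 0) by ring. rewrite Cmod_0; lra. }
rewrite <- Hz, <- He.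
- apply Hw. eapply Rlt_le_trans; [exact Hwd | apply Rmin_l].
- eapply Rlt_le_trans; [exact Hwd | apply Rmin_r].
Qed.

Lemma cderiv_eq f z l l' : l = l' -> cderiv f z l -> cderiv f z l'.
Proof. intros ->; auto. Qed.

Lemma cderiv_unique f z l : cderiv f z l -> C_derive f z = l.
Proof. intros H; apply is_C_derive_unique, cderiv_is_derive, H. Qed.

Lemma cderiv_const c z : cderiv (fun _ => c) z 0.
Proof. apply cderiv_abs.
apply (is_derive_const (K := C_AbsRing) (V := AbsRing_NormedModule C_AbsRing)). Qed.

Lemma cderiv_id z : cderiv (fun w => w) z 1.
Proof. apply cderiv_abs. apply (is_derive_id (K := C_AbsRing)). Qed.

Lemma cderiv_plus f g z a b :
  cderiv f z a -> cderiv g z b -> cderiv (fun w => f w + g w) z (a + b).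
Proof.
rewrite !cderiv_abs. intros Hf Hg.
exact (is_derive_plus (K := C_AbsRing) (V := AbsRing_NormedModule C_AbsRing) f g z a b Hf Hg).
Qed.

Lemma cderiv_mult f g z a b :
  cderiv f z a -> cderiv g z b -> cderiv (fun w => f w * g w) z (a * g z + f z * b).
Proof.
rewrite !cderiv_abs. intros Hf Hg.
exact (is_derive_mult (K := C_AbsRing) f g z a b Hf Hg Cmult_comm).
Qed.

Lemma cderiv_comp f g z a b :
  cderiv f (g z) a -> cderiv g z b -> cderiv (fun w => f (g w)) z (a * b).
Proof.
rewrite !cderiv_abs. intros Hf Hg.
replace (a * b) with (b * a) by ring.
exact (is_derive_comp (K := C_AbsRing) (V := AbsRing_NormedModule C_AbsRing) f g z a b Hf Hg).
Qed.

Lemma cderiv_scal c f z a : cderiv f z a -> cderiv (fun w => c * f w) z (c * a).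
Proof.
intros Hf. eapply cderiv_eq; [|exact (cderiv_mult _ _ z _ _ (cderiv_const c z) Hf)].
simpl; ring.
Qed.

Lemma cderiv_pow n z : cderiv (fun w => w ^ n) z (INR n * z ^ pred n).
Proof.
induction n as [|n IH].
- eapply cderiv_eq; [|exact (cderiv_const 1 z)]. simpl; ring.
- eapply cderiv_eq; [|exact (cderiv_mult _ _ z _ _ (cderiv_id z) IH)].
  rewrite S_INR, RtoC_plus. destruct n; simpl; ring.
Qed.

Lemma cderiv_Cinv (z : C) : z <> 0 -> cderiv Cinv z (- / z ^ 2).
Proof.
intros Hz eps Heps. assert (Hm := proj1 (Cmod_gt_0 z) Hz).
set (m := Cmod z) in *.
set (d := Rmin (m / 2) (eps * m ^ 3 / 2)).
assert (Hd1 : (d <= m / 2)%R) by apply Rmin_l.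
assert (Hd2 : (d <= eps * m ^ 3 / 2)%R) by apply Rmin_r.
assert (Hm3 : (0 < m ^ 3)%R) by (apply pow_lt; assumption).
exists d. split.
{ apply Rmin_pos; [lra|]. assert (0 < eps * m ^ 3)%R by (apply Rmult_lt_0_compat; assumption). lra.
  }
intros w Hw.
assert (Hwm : (m / 2 <= Cmod w)%R).
{ assert (m <= Cmod w + Cmod (w - z))%R; [|lra].
  rewrite <- (Cmod_opp (w - z)). unfold m. replace z with (w + - (w - z)) at 1 by ring.
  apply Cmod_triangle. }
assert (Hw0 : w <> 0) by (apply Cmod_gt_0; lra).
(* The remainder is exactly (w - z)^2 / (w z^2), and |w| >= |z| / 2. *)
replace (/ w - / z - - / z ^ 2 * (w - z)) with ((w - z) * (w - z) * (/ w * / z ^ 2)).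
2: { field. split; assumption. }
rewrite !Cmod_mult, !Cmod_inv, Cmod_pow by (try assumption; apply Cpow_nz; assumption).
fold m. set (e := Cmod (w - z)) in *. assert (He : (0 <= e)%R) by apply Cmod_ge_0.
replace (e * e * (/ Cmod w * / m ^ 2))%R with ((e * (/ Cmod w * / m ^ 2)) * e)%R by ring.
apply Rmult_le_compat_r; [exact He|].
apply Rle_trans with ((eps * m ^ 3 / 2) * (/ (m / 2) * / m ^ 2))%R.
- apply Rmult_le_compat; [exact He | | lra |].
  + apply Rmult_le_pos; left; apply Rinv_0_lt_compat; [lra | apply pow_lt; assumption].
  + apply Rmult_le_compat_r; [left; apply Rinv_0_lt_compat, pow_lt; assumption|].
    apply Rinv_le_contravar; lra.
- right. field. lra.
Qed.

Lemma im_le_Cmod z : (Rabs (Im z) <= Cmod z)%R.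
Proof. eapply Rle_trans; [|apply Rmax_Cmod]. apply Rmax_r. Qed.

Lemma Cmod_le_2_Rmax z : (Cmod z <= 2 * Rmax (Rabs (fst z)) (Rabs (snd z)))%R.
Proof.
eapply Rle_trans; [apply Cmod_2Rmax|].
apply Rmult_le_compat_r; [eapply Rle_trans; [apply Rabs_pos|apply Rmax_l]|].
replace 2%R with (sqrt (2 * 2)) at 2 by (apply sqrt_square; lra).
apply sqrt_le_1; lra.
Qed.

(** The Cauchy-Riemann equations: both components are differentiable as functions of
    two real variables, with gradients (Re l, - Im l) and (Im l, Re l).  This turns
    the exponential and the logarithm, and restrictions to real curves, into real
    two-variable calculus. *)
Lemma cderiv_CR f x y l :
  cderiv f (x, y) l <->
  differentiable_pt_lim (fun u v => Re (f (u, v))) x y (Re l) (- Im l)%R /\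
  differentiable_pt_lim (fun u v => Im (f (u, v))) x y (Im l) (Re l).
Proof.
split.
- intros H.
  assert (B : forall eps : posreal, locally_2d (fun u v =>
    Cmod (f (u, v) - f (x, y) - l * ((u, v) - (x, y))) <=
      eps * Rmax (Rabs (u - x)) (Rabs (v - y)))%R x y).
  { intros eps.
    assert (He : (0 < eps / 2)%R) by (apply Rdiv_lt_0_compat; [apply cond_pos|lra]).
    destruct (H _ He) as [d [Hd Hw]].
    exists (mkposreal (d / 2) (ltac:(lra) : (0 < d / 2)%R)).
    intros u v Hu Hv; simpl in Hu, Hv.
    assert (HC : (Cmod ((u, v) - (x, y)) <= 2 * Rmax (Rabs (u - x)) (Rabs (v - y)))%R)
      by apply Cmod_le_2_Rmax.
    assert (HM : (Rmax (Rabs (u - x)) (Rabs (v - y)) < d / 2)%R)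
      by (apply Rmax_lub_lt; assumption).
    eapply Rle_trans; [apply Hw; lra|].
    apply Rle_trans with (eps / 2 * (2 * Rmax (Rabs (u - x)) (Rabs (v - y))))%R;
      [apply Rmult_le_compat_l; lra | right; field]. }
  split; intros eps; destruct (B eps) as [d Hd]; exists d; intros u v Hu Hv;
    (eapply Rle_trans; [|exact (Hd u v Hu Hv)]).
  + eapply Rle_trans; [|apply re_le_Cmod]. right; f_equal.
    destruct l, (f (u, v)), (f (x, y)); simpl; ring.
  + eapply Rle_trans; [|apply im_le_Cmod]. right; f_equal.
    destruct l, (f (u, v)), (f (x, y)); simpl; ring.
- intros [H1 H2] eps Heps.
  assert (He : (0 < eps / 2)%R) by lra.
  destruct (H1 (mkposreal _ He)) as [d1 Hd1].
  destruct (H2 (mkposreal _ He)) as [d2 Hd2].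
  exists (Rmin d1 d2); split; [apply Rmin_pos; apply cond_pos|].
  intros [u v] Hw.
  assert (HR := Rmax_Cmod ((u,v)-(x,y))). simpl in HR.
  set (m := Rmax (Rabs (u + - x)) (Rabs (v + - y))) in *.
  assert (Hu : (Rabs (u - x) <= m)%R) by apply Rmax_l.
  assert (Hv : (Rabs (v - y) <= m)%R) by apply Rmax_r.
  assert (Hm1 := Rmin_l d1 d2). assert (Hm2 := Rmin_r d1 d2).
  specialize (Hd1 u v ltac:(lra) ltac:(lra)).
  specialize (Hd2 u v ltac:(lra) ltac:(lra)).
  simpl in Hd1, Hd2. unfold Rminus in Hd1, Hd2. fold m in Hd1, Hd2.
  eapply Rle_trans; [apply Cmod_le_2_Rmax|].
  apply Rle_trans with (2 * (eps / 2 * m))%R.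
  + apply Rmult_le_compat_l; [lra|]. apply Rmax_lub.
    * eapply Rle_trans; [|exact Hd1]. right; f_equal.
      destruct l, (f (u,v)), (f (x,y)); simpl; ring.
    * eapply Rle_trans; [|exact Hd2]. right; f_equal.
      destruct l, (f (u,v)), (f (x,y)); simpl; ring.
  + replace (2 * (eps/2*m))%R with (eps * m)%R by field.
    apply Rmult_le_compat_l; [lra|exact HR].
Qed.

Lemma cderiv_curve f (g1 g2 : R -> R) t d1 d2 l :
  is_derive g1 t d1 -> is_derive g2 t d2 -> cderiv f (g1 t, g2 t) l ->
  is_derive (fun s => Re (f (g1 s, g2 s))) t (Re (l * (d1, d2))) /\
  is_derive (fun s => Im (f (g1 s, g2 s))) t (Im (l * (d1, d2))).
Proof.
intros H1 H2 H. apply is_derive_Reals in H1. apply is_derive_Reals in H2.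
apply cderiv_CR in H. destruct H as [Hr Hi].
split; apply is_derive_Reals.
- assert (K := derivable_pt_lim_comp_2d _ _ _ _ _ _ _ _ Hr H1 H2).
  replace (Re (l * (d1, d2))) with (Re l * d1 + - Im l * d2)%R by (destruct l; simpl; ring).
  exact K.
- assert (K := derivable_pt_lim_comp_2d _ _ _ _ _ _ _ _ Hi H1 H2).
  replace (Im (l * (d1, d2))) with (Im l * d1 + Re l * d2)%R by (destruct l; simpl; ring).
  exact K.
Qed.

Lemma differentiable_pt_lim_Rmult x y : differentiable_pt_lim Rmult x y y x.
Proof.
intros eps. exists eps. intros u v Hu Hv.
replace (u * v - x * y - (y * (u - x) + x * (v - y)))%R with ((u - x) * (v - y))%R by ring.
rewrite Rabs_mult. apply Rmult_le_compat; try apply Rabs_pos; [lra | apply Rmax_r].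
Qed.

Lemma differentiable_pt_lim_Rplus x y : differentiable_pt_lim Rplus x y 1 1.
Proof.
intros eps. exists eps. intros u v _ _.
replace (u + v - (x + y) - (1 * (u - x) + 1 * (v - y)))%R with 0%R by ring.
rewrite Rabs_R0. apply Rmult_le_pos; [left; apply cond_pos|].
eapply Rle_trans; [apply Rabs_pos|apply Rmax_l].
Qed.

Lemma differentiable_pt_lim_fst x y : differentiable_pt_lim (fun u _ => u) x y 1 0.
Proof. apply differentiable_pt_lim_proj1_0, derivable_pt_lim_id. Qed.

Lemma differentiable_pt_lim_snd x y : differentiable_pt_lim (fun _ v => v) x y 0 1.
Proof.
intros eps. exists eps. intros u v Hu Hv.
replace (v - y - (0 * (u - x) + 1 * (v - y)))%R with 0%R by ring.
rewrite Rabs_R0. apply Rmult_le_pos; [left; apply cond_pos|].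
eapply Rle_trans; [apply Rabs_pos|apply Rmax_l].
Qed.

Lemma differentiable_pt_lim_mult_fct f g x y f1 f2 g1 g2 :
  differentiable_pt_lim f x y f1 f2 -> differentiable_pt_lim g x y g1 g2 ->
  differentiable_pt_lim (fun u v => f u v * g u v)%R x y
    (g x y * f1 + f x y * g1) (g x y * f2 + f x y * g2).
Proof.
intros Hf Hg.
exact (differentiable_pt_lim_comp _ _ _ _ _ _ _ _ _ _ _
  (differentiable_pt_lim_Rmult (f x y) (g x y)) Hf Hg).
Qed.

Lemma differentiable_pt_lim_comp_fct (h : R -> R) f x y f1 f2 d :
  derivable_pt_lim h (f x y) d -> differentiable_pt_lim f x y f1 f2 ->
  differentiable_pt_lim (fun u v => h (f u v)) x y (d * f1) (d * f2).
Proof.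
intros Hh Hf.
assert (K := differentiable_pt_lim_comp _ _ _ _ _ _ _ _ _ _ _
  (differentiable_pt_lim_proj1_0 h (f x y) (f x y) d Hh) Hf Hf).
replace (d * f1)%R with (d * f1 + 0 * f1)%R by ring.
replace (d * f2)%R with (d * f2 + 0 * f2)%R by ring. exact K.
Qed.

Lemma unit_disk_0 : unit_disk 0.
Proof. unfold unit_disk. rewrite Cmod_0. lra. Qed.

Lemma unit_disk_RtoC (r : R) : (0 <= r < 1)%R -> unit_disk r.
Proof. intros H. unfold unit_disk. rewrite Cmod_R, Rabs_pos_eq; lra. Qed.

Lemma unit_disk_pow n z : (0 < n)%nat -> unit_disk z -> unit_disk (z ^ n).
Proof.
unfold unit_disk. intros Hn Hz. rewrite Cmod_pow. assert (T := Cmod_ge_0 z).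
apply pow_lt_1_compat; [split; assumption | exact Hn].
Qed.

Lemma unit_disk_open z : unit_disk z -> exists r, (0 < r)%R /\ forall w, (Cmod (w - z) < r)%R ->
  unit_disk w.
Proof.
unfold unit_disk. intros Hz. exists (1 - Cmod z)%R. split; [lra|]. intros w Hw.
replace w with (z + (w - z)) by ring. eapply Rle_lt_trans; [apply Cmod_triangle|]. lra.
Qed.

(** The disk is star-shaped about 0, so it is enough to look along radii. *)
Lemma cderiv_0_disk_const f :
  (forall z, unit_disk z -> cderiv f z 0) -> forall z, unit_disk z -> f z = f 0.
Proof.
intros Hf [x y] Hz.
assert (D : forall t, (0 <= t <= 1)%R ->
  is_derive (fun s => Re (f (s * x, s * y)%R)) t 0%R /\ is_derive
    (fun s => Im (f (s * x, s * y)%R)) t 0%R).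
{ intros t Ht.
  assert (Hd : unit_disk (t * x, t * y)%R).
  { replace ((t * x, t * y)%R : C) with (t * (x, y)) by (apply injective_projections; simpl; ring).
    unfold unit_disk in *. rewrite Cmod_mult, Cmod_R, Rabs_pos_eq by lra.
    assert (T := Cmod_ge_0 (x, y)). nra. }
  destruct (cderiv_curve f (fun s => s * x)%R (fun s => s * y)%R t x y 0) as [A B].
  - auto_derive; [trivial|ring].
  - auto_derive; [trivial|ring].
  - apply Hf, Hd.
  - split.
    + refine (eq_ind _ (fun l => is_derive _ t l) A _ _). simpl; ring.
    + refine (eq_ind _ (fun l => is_derive _ t l) B _ _). simpl; ring. }
assert (ER := eq_is_derive (V := R_NormedModule) _ 0 1 (fun t Ht => proj1 (D t Ht)) Rlt_0_1).
assert (EI := eq_is_derive (V := R_NormedModule) _ 0 1 (fun t Ht => proj2 (D t Ht)) Rlt_0_1).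
cbv beta in ER, EI. rewrite !Rmult_0_l, !Rmult_1_l in ER, EI.
apply injective_projections; symmetry; assumption.
Qed.

(** * The complex exponential and logarithm *)

Lemma cderiv_Cexp z : cderiv Cexp z (Cexp z).
Proof.
destruct z as [x y]. apply cderiv_CR.
assert (Hex := differentiable_pt_lim_comp_fct exp _ x y _ _ _ (derivable_pt_lim_exp x) (differentiable_pt_lim_fst x y)).
assert (Hc := differentiable_pt_lim_comp_fct cos _ x y _ _ _ (derivable_pt_lim_cos y) (differentiable_pt_lim_snd x y)).
assert (Hs := differentiable_pt_lim_comp_fct sin _ x y _ _ _ (derivable_pt_lim_sin y) (differentiable_pt_lim_snd x y)).
split.
- assert (K := differentiable_pt_lim_mult_fct _ _ _ _ _ _ _ _ Hex Hc).
  eapply differentiable_pt_lim_ext.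
  2: { match goal with |- differentiable_pt_lim _ _ _ ?a ?b =>
     match type of K with differentiable_pt_lim _ _ _ ?c ?d =>
     replace a with c; [replace b with d; [exact K|]|] end end; unfold Cexp; simpl; ring. }
  exists (mkposreal 1 Rlt_0_1). intros u v _ _. unfold Cexp; simpl; ring.
- assert (K := differentiable_pt_lim_mult_fct _ _ _ _ _ _ _ _ Hex Hs).
  eapply differentiable_pt_lim_ext.
  2: { match goal with |- differentiable_pt_lim _ _ _ ?a ?b =>
     match type of K with differentiable_pt_lim _ _ _ ?c ?d =>
     replace a with c; [replace b with d; [exact K|]|] end end; unfold Cexp; simpl; ring. }
  exists (mkposreal 1 Rlt_0_1). intros u v _ _. unfold Cexp; simpl; ring.
Qed.

Lemma Cexp_plus z w : Cexp (z + w) = Cexp z * Cexp w.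
Proof.
destruct z as [x y], w as [u v]. unfold Cexp; simpl.
rewrite exp_plus, cos_plus, sin_plus. apply injective_projections; simpl; ring.
Qed.

Lemma Cexp_0 : Cexp 0 = 1.
Proof. unfold Cexp; simpl. rewrite exp_0, cos_0, sin_0. apply injective_projections; simpl; ring.
Qed.

Lemma Cmod_Cexp z : Cmod (Cexp z) = exp (Re z).
Proof.
unfold Cexp. rewrite Cmod_mult, Cmod_R, Rabs_pos_eq by (left; apply exp_pos).
unfold Cmod; simpl. replace (_ + _)%R with 1%R; [rewrite sqrt_1; ring|].
generalize (sin2_cos2 (Im z)); unfold Rsqr, Im; lra.
Qed.

Lemma Cexp_neq_0 z : Cexp z <> 0.
Proof. apply Cmod_gt_0. rewrite Cmod_Cexp. apply exp_pos. Qed.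

Lemma Cexp_pow z n : Cexp z ^ n = Cexp (INR n * z).
Proof.
induction n as [|n IH].
- simpl. replace (0 * z) with (RtoC 0) by ring. symmetry; apply Cexp_0.
- rewrite Cpow_S, IH, S_INR, RtoC_plus, <- Cexp_plus. f_equal; ring.
Qed.

(** The half-open range makes s = 0 the only angle excluded when (a, b) is not (1, 0),
    as the tangent-circle argument needs. *)
Lemma unit_circle_angle (a b : R) : (a * a + b * b = 1)%R ->
  exists s, (0 <= s < 2 * PI)%R /\ cos s = a /\ sin s = b.
Proof.
intros H. assert (HP := PI_RGT_0).
assert (Ha : (-1 <= a <= 1)%R) by nra.
assert (Hb := acos_bound a). assert (Hc := cos_acos a Ha). assert (Hs := sin_acos a Ha).
replace (1 - Rsqr a)%R with (Rsqr b) in Hs by (unfold Rsqr; lra).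
rewrite sqrt_Rsqr_abs in Hs.
destruct (Rle_lt_dec 0 b) as [Hb0|Hb0].
- exists (acos a). rewrite Rabs_pos_eq in Hs by lra. repeat split; lra.
- exists (2 * PI - acos a)%R. rewrite Rabs_left in Hs by lra.
  rewrite cos_minus, sin_minus, cos_2PI, sin_2PI, Hc, Hs.
  assert (acos a <> 0)%R. { intros E. rewrite E, sin_0 in Hs. lra. }
  repeat split; lra.
Qed.

Lemma Cexp_surj (z : C) : z <> 0 -> exists u, Cexp u = z /\ Re u = ln (Cmod z).
Proof.
intros Hz. assert (Hm := proj1 (Cmod_gt_0 z) Hz). destruct z as [x y].
assert (Q := Cmod2_alt (x, y)). simpl in Q. set (m := Cmod (x, y)) in *.
destruct (unit_circle_angle (x / m) (y / m)) as [t [_ [Hc Hs]]].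
{ replace (x / m * (x / m) + y / m * (y / m))%R with ((x * (x * 1) + y * (y * 1)) / (m * (m * 1)))%R by (field; lra).
  rewrite <- Q. field; lra. }
exists (ln m, t). split; [|reflexivity].
unfold Cexp; simpl. rewrite exp_ln by exact Hm.
apply injective_projections; simpl; rewrite Hc, Hs; field; lra.
Qed.

(** The principal logarithm, by a formula that is valid on the right half plane only;
    the convexity argument never leaves that half plane. *)
Definition Clog (z : C) : C :=
  (ln (Re z ^ 2 + Im z ^ 2) / 2, atan (Im z / Re z))%R.

Lemma Clog_1 : Clog 1 = 0.
Proof.
unfold Clog. simpl Re; simpl Im.
replace (1 ^ 2 + 0 ^ 2)%R with 1%R by ring. rewrite ln_1.
replace (0 / 1)%R with 0%R by field. rewrite atan_0.
apply injective_projections; simpl; field.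
Qed.

Lemma cos_atan_pos x : (0 < cos (atan x))%R.
Proof. generalize (atan_bound x); intros [? ?]; apply cos_gt_0; lra. Qed.

Lemma Cexp_Clog z : (0 < Re z)%R -> Cexp (Clog z) = z.
Proof.
destruct z as [x y]; unfold Cexp, Clog; simpl Re; simpl Im; intros Hx.
assert (Hp : (0 < x ^ 2 + y ^ 2)%R) by nra.
set (m := exp (ln (x^2+y^2) / 2)).
assert (Hm : (0 < m)%R) by apply exp_pos.
assert (Hm2 : (m * m = x^2+y^2)%R).
{ unfold m. rewrite <- exp_plus.
  replace (ln (x^2+y^2) / 2 + ln (x^2+y^2) / 2)%R with (ln (x^2+y^2)) by field. apply exp_ln, Hp. }
assert (Hc := cos_atan_pos (y/x)).
assert (Hs : (sin (atan (y/x)) * x = y * cos (atan (y/x)))%R).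
{ assert (T := tan_atan (y/x)). unfold tan in T. 
  replace (sin (atan (y/x))) with (sin (atan (y/x)) / cos (atan (y/x)) * cos (atan (y/x)))%R
    by (field; lra).
  rewrite T. field. lra. }
assert (H1 := sin2_cos2 (atan (y/x))). unfold Rsqr in H1.
set (c := cos (atan (y/x))) in *. set (s := sin (atan (y/x))) in *.
assert (Hmc : (m * c = x)%R).
{ assert (((m * c) * (m * c) = x * x)%R).
  { replace (m*c*(m*c))%R with ((m*m)*(c*c))%R by ring. rewrite Hm2.
    replace ((x^2+y^2)*(c*c))%R with (x*x*(c*c) + (y*c)*(y*c))%R by ring.
    rewrite <- Hs. replace (x*x)%R with (x*x*(s*s+c*c))%R at 2 by (rewrite H1; ring). ring. }
  assert (0 < m * c)%R by (apply Rmult_lt_0_compat; assumption). nra. }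
assert (Hms : (m * s = y)%R).
{ apply Rmult_eq_reg_r with x; [|lra].
  replace (m*s*x)%R with (m*(s*x))%R by ring. rewrite Hs.
  replace (m*(y*c))%R with (y*(m*c))%R by ring. rewrite Hmc. ring. }
change (RtoC m * (c, s) = (x, y)). clearbody m.
apply injective_projections; simpl; rewrite <- ?Hmc, <- ?Hms; ring.
Qed.

Lemma cderiv_Clog z : (0 < Re z)%R -> cderiv Clog z (/ z).
Proof.
destruct z as [x y]; simpl; intros Hx.
assert (Hp : (0 < x ^ 2 + y ^ 2)%R) by nra.
apply cderiv_CR.
assert (Hf := differentiable_pt_lim_fst x y).
assert (Hg := differentiable_pt_lim_snd x y).
assert (D2 : forall t, derivable_pt_lim (fun t => t ^ 2)%R t (2 * t)%R).
{ intros t. apply is_derive_Reals. auto_derive; [trivial|ring]. }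
assert (Hf2 := differentiable_pt_lim_comp_fct _ _ x y _ _ _ (D2 x) Hf).
assert (Hg2 := differentiable_pt_lim_comp_fct _ _ x y _ _ _ (D2 y) Hg).
assert (HN := differentiable_pt_lim_comp _ _ _ x y _ _ _ _ _ _ (differentiable_pt_lim_Rplus _ _) Hf2 Hg2).
cbv beta in HN.
assert (DL : derivable_pt_lim (fun t => ln t / 2)%R (x ^ 2 + y ^ 2)%R (/ (x^2+y^2) / 2)%R).
{ apply is_derive_Reals. auto_derive; [exact Hp| field; lra]. }
assert (DI : derivable_pt_lim (fun t => / t)%R x (- / x ^ 2)%R).
{ apply is_derive_Reals. auto_derive; [lra| field; lra]. }
assert (HI := differentiable_pt_lim_comp_fct _ _ x y _ _ _ DI Hf).
assert (HQ := differentiable_pt_lim_mult_fct _ _ x y _ _ _ _ Hg HI).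
cbv beta in HQ.
assert (DA : derivable_pt_lim atan (y * / x)%R (/ (1 + (y * / x)^2))%R).
{ apply is_derive_Reals. auto_derive; [trivial | simpl; rewrite Rmult_1_l, Rmult_1_r; reflexivity].
  }
split.
- assert (K := differentiable_pt_lim_comp_fct _ _ x y _ _ _ DL HN).
  match goal with |- differentiable_pt_lim _ _ _ ?a ?b =>
     match type of K with differentiable_pt_lim _ _ _ ?c ?d =>
     replace a with c; [replace b with d; [exact K|]|] end end; simpl; field; simpl in Hp; lra.
- assert (K := differentiable_pt_lim_comp_fct _ _ x y _ _ _ DA HQ).
  match goal with |- differentiable_pt_lim _ _ _ ?a ?b =>
     match type of K with differentiable_pt_lim _ _ _ ?c ?d =>
     replace a with c; [replace b with d;
       [exact K|]|] end end; simpl; field; simpl in Hp; repeat split; nra.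
Qed.

(** * Complex series *)

Notation is_Cseries := (is_series (K := C_AbsRing) (V := C_NormedModule)).

Notation Csum := (sum_n (G := C_AbelianMonoid)).

Lemma Csum_Sn (u : nat -> C) n :
  Csum u (S n) = Csum u n + u (S n).
Proof. exact (sum_Sn (G := C_AbelianMonoid) u n). Qed.

Lemma Csum_O (u : nat -> C) : Csum u 0 = u O.
Proof. exact (sum_O (G := C_AbelianMonoid) u). Qed.

Lemma is_Cseries_components (u : nat -> C) s : is_Cseries u s ->
  is_series (fun k => Re (u k)) (Re s) /\ is_series (fun k => Im (u k)) (Im s).
Proof.
intros H.
assert (E : forall N, Csum u N = (sum_n (fun k => Re (u k)) N, sum_n (fun k => Im (u k)) N)).
{ induction N as [|N IH].
  - rewrite !sum_O. destruct (u O); reflexivity.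
  - rewrite !sum_Sn, IH. destruct (u (S N)); reflexivity. }
destruct s as [a b]; split.
- apply filterlim_ext with (fun N => fst (Csum u N)).
  { intros N. rewrite E. reflexivity. }
  eapply filterlim_comp; [exact H|].
  apply (continuous_fst (U := R_UniformSpace) (V := R_UniformSpace) a b).
- apply filterlim_ext with (fun N => snd (Csum u N)).
  { intros N. rewrite E. reflexivity. }
  eapply filterlim_comp; [exact H|].
  apply (continuous_snd (U := R_UniformSpace) (V := R_UniformSpace) a b).
Qed.

Lemma is_Cseries_unique (u : nat -> C) (s t : C) : is_Cseries u s -> is_Cseries u t -> s = t.
Proof.
intros H1 H2. apply is_Cseries_components in H1. apply is_Cseries_components in H2.
destruct H1 as [A B], H2 as [A' B'].
apply is_series_unique in A. apply is_series_unique in B.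
apply is_series_unique in A'. apply is_series_unique in B'.
destruct s, t; simpl in *; congruence.
Qed.

Lemma is_Cseries_plus (u v : nat -> C) (s t : C) : is_Cseries u s -> is_Cseries v t ->
  is_Cseries (fun k => u k + v k) (s + t).
Proof. exact (is_series_plus (K := C_AbsRing) (V := C_NormedModule) u v s t). Qed.

Lemma is_Cseries_minus (u v : nat -> C) (s t : C) : is_Cseries u s -> is_Cseries v t ->
  is_Cseries (fun k => u k - v k) (s - t).
Proof. exact (is_series_minus (K := C_AbsRing) (V := C_NormedModule) u v s t). Qed.

Lemma is_Cseries_scal (c : C) (u : nat -> C) (s : C) : is_Cseries u s -> is_Cseries
  (fun k => c * u k) (c * s).
Proof. exact (is_series_scal (K := C_AbsRing) (V := C_NormedModule) c u s). Qed.

Lemma is_Cseries_eq (u v : nat -> C) (s t : C) : (forall k, u k = v k) -> s = t ->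
  is_Cseries u s -> is_Cseries v t.
Proof. intros H ->. apply is_series_ext, H. Qed.

Lemma is_Cseries_shift (u : nat -> C) (s : C) : is_Cseries u s <-> is_Cseries
  (fun k => u (S k)) (s - u O).
Proof.
split; intros H.
- apply (is_series_incr_1 (K := C_AbsRing) (V := C_NormedModule)).
  apply is_Cseries_eq with u s; [reflexivity | | exact H].
  change (@eq C s (s - u O + u O)). ring.
- apply (is_series_decr_1 (K := C_AbsRing) (V := C_NormedModule)). exact H.
Qed.

(** A total choice of the sum, so that sums can be used as functions of a parameter. *)
Definition CSeries (u : nat -> C) : C :=
  (Series (fun k => Re (u k)), Series (fun k => Im (u k))).

Lemma CSeries_correct u :
  ex_series (K := C_AbsRing) (V := C_NormedModule) u -> is_Cseries u (CSeries u).
Proof.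
intros [s H]. assert (K := is_Cseries_components u s H). destruct K as [A B].
apply is_series_unique in A. apply is_series_unique in B.
unfold CSeries. rewrite A, B. destruct s; exact H.
Qed.

Lemma is_Cseries_le (u : nat -> C) (s : C) (b : nat -> R) B : is_Cseries u s -> is_series b B ->
  (forall k, Cmod (u k) <= b k)%R -> (Cmod s <= B)%R.
Proof.
intros Hu Hb Hle.
apply (is_lim_seq_le (fun N => Cmod (Csum u N)) (sum_n b) (Cmod s) B).
- induction n as [|n IH].
  + rewrite !sum_O. apply Hle.
  + rewrite !sum_Sn. eapply Rle_trans; [apply Cmod_triangle|].
    apply Rplus_le_compat; [exact IH | apply Hle].
- apply (filterlim_comp _ _ _ _ (norm (K := C_AbsRing) (V := C_NormedModule)) _ _ _ Hu).
  apply (filterlim_norm (K := C_AbsRing) (V := C_NormedModule)).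
- exact Hb.
Qed.

Lemma ex_Cseries_le (u : nat -> C) (b : nat -> R) : ex_series b ->
  (forall k, Cmod (u k) <= b k)%R -> ex_series (K := C_AbsRing) (V := C_NormedModule) u.
Proof.
intros Hb Hle.
exact (ex_series_le (K := C_AbsRing) (V := C_CompleteNormedModule) u b Hle Hb).
Qed.

Lemma is_Cseries_bounded (u : nat -> C) (s : C) : is_Cseries u s ->
  exists M, forall k, (Cmod (u k) <= M)%R.
Proof.
intros H.
destruct (filterlim_bounded (K := C_AbsRing) (V := C_NormedModule) (Csum u)) as [M HM].
{ exists s; exact H. }
assert (HM' : forall N, (Cmod (Csum u N) <= M)%R) by exact HM.
exists (M + M)%R. intros [|k].
- specialize (HM' 0%nat). rewrite sum_O in HM'.
  assert (0 <= Cmod (u 0%nat))%R by apply Cmod_ge_0. lra.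
- replace (u (S k)) with (Csum u (S k) + - Csum u k).
  + eapply Rle_trans; [apply Cmod_triangle|]. rewrite Cmod_opp.
    apply Rplus_le_compat; apply HM'.
  + rewrite sum_Sn. change (Csum u k + u (S k) + - Csum u k = u (S k)). ring.
Qed.

(** The coefficients of the power series U(z^n), when [u] are those of U. *)
Definition gap (n : nat) (u : nat -> C) (k : nat) : C :=
  if (k mod n =? 0)%nat then u (k / n)%nat else 0.

Lemma sum_gap n u N : (0 < n)%nat ->
  Csum (gap n u) N = Csum u (N / n).
Proof.
intros Hn. induction N as [|N IH].
- rewrite Nat.Div0.div_0_l, !Csum_O. unfold gap. now rewrite Nat.Div0.mod_0_l, Nat.Div0.div_0_l.
- rewrite Csum_Sn, IH. unfold gap.
  assert (E1 := Nat.div_mod_eq N n). assert (E2 := Nat.div_mod_eq (S N) n).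
  assert (B1 := Nat.mod_upper_bound N n ltac:(lia)).
  assert (B2 := Nat.mod_upper_bound (S N) n ltac:(lia)).
  destruct (Nat.eqb_spec (S N mod n) 0) as [H|H].
  + replace (S N / n)%nat with (S (N / n)) by nia.
    rewrite Csum_Sn. reflexivity.
  + replace (S N / n)%nat with (N / n)%nat by nia. apply Cplus_0_r.
Qed.

Lemma is_Cseries_gap n (u : nat -> C) (s : C) : (0 < n)%nat -> is_Cseries u s ->
  is_Cseries (gap n u) s.
Proof.
intros Hn H.
apply filterlim_ext with (fun N => Csum u (N / n)).
{ intros N. symmetry. apply sum_gap, Hn. }
apply (filterlim_comp _ _ _ (fun N => (N / n)%nat) (Csum u) eventually eventually).
- intros P [M HM]. exists (M * n)%nat. intros N HN. apply HM.
  apply Nat.div_le_lower_bound; lia.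
- exact H.
Qed.

Lemma gap_pow n (u : nat -> C) (z : C) k : (0 < n)%nat ->
  gap n (fun j => u j * (z ^ n) ^ j) k = gap n u k * z ^ k.
Proof.
intros Hn. unfold gap. destruct (Nat.eqb_spec (k mod n) 0) as [H|H]; [|ring].
rewrite <- Cpow_mult_r. f_equal. f_equal. assert (D := Nat.div_mod_eq k n). lia.
Qed.

(** * Power series on the unit disk *)

(** Convergence on the whole disk is part of the predicate, so that it describes
    a holomorphic function by its Taylor series. *)
Definition disk_series (a : nat -> C) (f : C -> C) : Prop :=
  forall z, unit_disk z -> is_Cseries (fun k => a k * z ^ k) (f z).

Lemma disk_series_unique a f g : disk_series a f -> disk_series a g ->
  forall z, unit_disk z -> f z = g z.
Proof. intros Hf Hg z Hz. exact (is_Cseries_unique _ _ _ (Hf z Hz) (Hg z Hz)). Qed.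

Lemma disk_series_ext a b f : (forall k, a k = b k) -> disk_series a f -> disk_series b f.
Proof.
intros E H z Hz. refine (is_Cseries_eq _ _ _ _ _ (eq_refl _) (H z Hz)).
intros k; simpl; now rewrite E.
Qed.

Lemma disk_series_bounded_coeff a : (forall k, (Cmod (a k) <= 1)%R) ->
  disk_series a (fun z => CSeries (fun k => a k * z ^ k)).
Proof.
intros Ha z Hz. unfold unit_disk in Hz. apply CSeries_correct.
apply (ex_Cseries_le _ (fun k => Cmod z ^ k)%R).
- apply ex_series_geom. rewrite Rabs_pos_eq by apply Cmod_ge_0. exact Hz.
- intros k. rewrite Cmod_mult, Cmod_pow. rewrite <- (Rmult_1_l (Cmod z ^ k)) at 2.
  apply Rmult_le_compat_r; [apply pow_le, Cmod_ge_0 | apply Ha].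
Qed.

(** The terms at a point between r and 1 are bounded because the series converges there;
    this brings in the theory of real power series for the moduli of the
    coefficients. *)
Lemma disk_series_CV_radius a f r : disk_series a f -> (0 <= r < 1)%R ->
  Rbar_lt (Rabs r) (CV_radius (fun k => Cmod (a k))).
Proof.
intros Hf Hr. set (s := ((r + 1) / 2)%R). assert (Hs : (0 <= s < 1)%R) by (unfold s; lra).
destruct (is_Cseries_bounded _ _ (Hf _ (unit_disk_RtoC s Hs))) as [M HM].
apply Rbar_lt_le_trans with (Finite s).
- simpl. rewrite Rabs_pos_eq by lra. unfold s; lra.
- apply CV_radius_bounded. exists M. intros k. eapply Rle_trans; [|apply (HM k)].
  rewrite Cmod_mult, <- RtoC_pow, Cmod_R, Rabs_mult. right; f_equal.
  apply Rabs_pos_eq, Cmod_ge_0.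
Qed.

Lemma disk_series_abs a f r : disk_series a f -> (0 <= r < 1)%R ->
  ex_series (fun k => Cmod (a k) * r ^ k)%R.
Proof.
intros Hf Hr.
eapply ex_series_ext; [|apply CV_disk_inside, (disk_series_CV_radius a f r Hf Hr)].
intros k; simpl. apply Rabs_pos_eq, Rmult_le_pos; [apply Cmod_ge_0|apply pow_le; lra].
Qed.

Definition Cderive_coeff (a : nat -> C) (k : nat) : C := INR (S k) * a (S k).

Lemma Cmod_Cderive_coeff a k :
  Cmod (Cderive_coeff a k) = PS_derive (fun k => Cmod (a k)) k.
Proof.
unfold Cderive_coeff, PS_derive.
rewrite Cmod_mult, Cmod_R, Rabs_pos_eq; [reflexivity|apply pos_INR].
Qed.

(** The quadratic Taylor remainder of a power, uniform on the disk of radius r.  The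
    remainders satisfy R_(k+1) = w R_k + k z^(k-1) (w - z)^2, which gives the bound by
    induction. *)
Lemma Cpow_second_difference (z w : C) (r : R) k :
  (Cmod z <= r)%R -> (Cmod w <= r)%R ->
  (Cmod (w ^ S k - z ^ S k - INR (S k) * z ^ k * (w - z))
    <= INR k * INR (S k) * r ^ (pred k) * Cmod (w - z) ^ 2)%R.
Proof.
intros Hz Hw. assert (Hr : (0 <= r)%R) by (eapply Rle_trans; [apply Cmod_ge_0|exact Hz]).
induction k as [|k IH].
- replace (w ^ 1 - z ^ 1 - INR 1 * z ^ 0 * (w - z)) with (RtoC 0) by (simpl; ring).
  rewrite Cmod_0. simpl. lra.
- replace (w ^ S (S k) - z ^ S (S k) - INR (S (S k)) * z ^ S k * (w - z))
    with (w * (w ^ S k - z ^ S k - INR (S k) * z ^ k * (w - z)) + INR (S k) * z ^ k * (w - z) ^ 2).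
  2: { rewrite (S_INR (S k)), RtoC_plus. simpl. ring. }
  eapply Rle_trans; [apply Cmod_triangle|].
  rewrite !Cmod_mult, Cmod_R, (Rabs_pos_eq (INR (S k))), !Cmod_pow by apply pos_INR.
  set (d := (Cmod (w - z) ^ 2)%R) in *.
  assert (Hd : (0 <= d)%R) by (apply pow2_ge_0).
  apply Rle_trans with (r * (INR k * INR (S k) * r ^ pred k * d) + INR (S k) * r ^ k * d)%R.
  + apply Rplus_le_compat.
    * apply Rmult_le_compat; try apply Cmod_ge_0; assumption.
    * apply Rmult_le_compat_r; [exact Hd|]. apply Rmult_le_compat_l; [apply pos_INR|].
      apply pow_incr; split; [apply Cmod_ge_0|exact Hz].
  + replace (r * (INR k * INR (S k) * r ^ pred k * d))%R with (INR k * INR (S k) * r ^ k * d)%R.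
    2: { destruct k; simpl; ring. }
    replace (INR k * INR (S k) * r ^ k * d + INR (S k) * r ^ k * d)%R
      with (INR (S k) * INR (S k) * (r ^ k * d))%R by (rewrite (S_INR k); ring).
    simpl pred. rewrite (S_INR (S k)).
    assert (0 <= INR (S k))%R by apply pos_INR.
    assert (0 <= r ^ k * d)%R by (apply Rmult_le_pos; [apply pow_le|]; assumption).
    nra.
Qed.

(** Term-by-term differentiation.  The remainders of the single terms add up to at
    most B |w - z|^2, where B is the sum of the second formal derivative of the
    series of moduli at a radius r between |z| and 1; formal derivatives of a
    real power series have the same radius of convergence. *)
Lemma disk_series_derive a f : disk_series a f ->
  exists f', disk_series (Cderive_coeff a) f' /\
    forall z, unit_disk z -> cderiv f z (f' z).
Proof.
intros Hf.
exists (fun z => CSeries (fun k => Cderive_coeff a k * z ^ k)).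
assert (Hcv : forall r, (0 <= r < 1)%R ->
  ex_series (fun k => PS_derive (fun k => Cmod (a k)) k * r ^ k)%R /\
  ex_series (fun k => PS_derive (PS_derive (fun k => Cmod (a k))) k * r ^ k)%R).
{ intros r Hr. assert (H := disk_series_CV_radius a f r Hf Hr). split.
  - apply ex_series_Rabs, CV_disk_inside. rewrite CV_radius_derive. exact H.
  - apply ex_series_Rabs, CV_disk_inside. rewrite !CV_radius_derive. exact H. }
assert (H' : disk_series (Cderive_coeff a) (fun z => CSeries (fun k => Cderive_coeff a k * z ^ k))).
{ intros z Hz. apply CSeries_correct.
  eapply ex_Cseries_le; [apply (proj1 (Hcv (Cmod z) (conj (Cmod_ge_0 z) Hz)))|].
  intros k. simpl. rewrite Cmod_mult, Cmod_Cderive_coeff, Cmod_pow. right; reflexivity. }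
split; [exact H'|].
intros z Hz eps Heps.
set (r := ((Cmod z + 1) / 2)%R).
assert (Hz0 := Cmod_ge_0 z). unfold unit_disk in Hz.
assert (Hr : (0 <= r < 1)%R) by (unfold r; lra).
destruct (proj2 (Hcv r Hr)) as [B HB].
assert (HBpos : (0 <= B)%R).
{ apply (is_lim_seq_le (fun _ => 0%R) (sum_n (fun k => PS_derive (PS_derive
    (fun k => Cmod (a k))) k * r ^ k)%R) 0%R B).
  - intros n. rewrite <- (Rmult_0_r (INR (S n))), <- sum_n_const. apply sum_n_m_le.
    intros k. unfold PS_derive.
    repeat apply Rmult_le_pos; try apply pos_INR; [apply Cmod_ge_0|apply pow_le; lra].
  - apply is_lim_seq_const.
  - exact HB. }
set (d := Rmin (r - Cmod z) (eps / (B + 1))).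
assert (Hd1 : (d <= r - Cmod z)%R) by apply Rmin_l.
assert (Hd2 : (d <= eps / (B + 1))%R) by apply Rmin_r.
exists d. split.
{ apply Rmin_pos; [unfold r; lra | apply Rdiv_lt_0_compat; lra]. }
intros w Hw.
assert (Hwr : (Cmod w <= r)%R).
{ replace w with (z + (w - z)) by ring. eapply Rle_trans; [apply Cmod_triangle|]. lra. }
assert (Hzr : (Cmod z <= r)%R) by (unfold r; lra).
set (g := CSeries (fun k => Cderive_coeff a k * z ^ k)).
assert (T : (Cmod (f w - f z - g * (w - z)) <= B * Cmod (w - z) ^ 2)%R).
{ assert (Sw := Hf w (Rle_lt_trans _ _ _ Hwr (proj2 Hr))).
  assert (Sz := Hf z Hz). assert (Sg := H' z Hz). fold g in Sg.
  assert (S1 := is_Cseries_minus _ _ _ _ Sw Sz).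
  apply is_Cseries_shift in S1.
  assert (S2 := is_Cseries_minus _ _ _ _ S1 (is_Cseries_scal (w - z) _ _ Sg)).
  assert (S5 := is_series_scal (K := R_AbsRing) (V := R_NormedModule) (Cmod (w - z) ^ 2)%R _ _ HB).
  set (D := (Cmod (w - z) ^ 2)%R) in *.
  (* The majorant starts with 0: the term of index 1 is linear in w. *)
  set (b := fun k => match k with O => 0%R | S k => (PS_derive (PS_derive
    (fun k => Cmod (a k))) k * r ^ k * D)%R end).
  cbv beta in S2.
  replace (f w - f z - (a O * w ^ 0 - a O * z ^ 0) - (w - z) * CSeries
    (fun k => Cderive_coeff a k * z ^ k))
    with (f w - f z - g * (w - z)) in S2 by (unfold g; simpl; ring).
  refine (is_Cseries_le _ _ b (B * D)%R S2 _ _).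
  { apply is_series_decr_1.
    match goal with |- is_series _ ?x => replace x with (D * B)%R end.
    - eapply is_series_ext; [|exact S5]. intros k; simpl.
      unfold scal; simpl; unfold mult; simpl; ring.
    - unfold plus, opp; simpl; ring. }
  intros k.
  replace (a (S k) * w ^ S k - a (S k) * z ^ S k - (w - z) * (Cderive_coeff a k * z ^ k))
    with (a (S k) * (w ^ S k - z ^ S k - INR (S k) * z ^ k * (w - z)))
    by (unfold Cderive_coeff; ring).
  rewrite Cmod_mult.
  assert (Q := Cpow_second_difference z w r k Hzr Hwr). fold D in Q.
  eapply Rle_trans; [apply Rmult_le_compat_l; [apply Cmod_ge_0|exact Q]|].
  destruct k as [|k].
  - simpl. lra.
  - unfold b, PS_derive. simpl pred. right; ring. }
eapply Rle_trans; [exact T|].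
assert (Hm := Cmod_ge_0 (w - z)).
replace (B * Cmod (w - z) ^ 2)%R with (B * Cmod (w - z) * Cmod (w - z))%R by ring.
apply Rmult_le_compat_r; [exact Hm|].
apply Rle_trans with ((B + 1) * (eps / (B + 1)))%R.
- apply Rmult_le_compat; lra.
- right; field; lra.
Qed.

Lemma disk_series_tail a f : disk_series a f ->
  exists f1, disk_series (fun k => a (S k)) f1 /\
    forall z, unit_disk z -> f z = a O + z * f1 z.
Proof.
intros Hf. exists (fun z => CSeries (fun k => a (S k) * z ^ k)).
assert (H1 : disk_series (fun k => a (S k)) (fun z => CSeries (fun k => a (S k) * z ^ k))).
{ intros z Hz. apply CSeries_correct. unfold unit_disk in Hz.
  assert (Hz0 := Cmod_ge_0 z).
  set (r := ((Cmod z + 1) / 2)%R).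
  assert (Hr : (0 < r < 1)%R) by (unfold r; lra).
  assert (Ha := disk_series_abs a f r Hf (conj (Rlt_le _ _ (proj1 Hr)) (proj2 Hr))).
  apply ex_series_incr_1 in Ha.
  apply (ex_series_scal (K := R_AbsRing) (/ r)%R) in Ha.
  refine (ex_Cseries_le _ _ Ha _).
  intros k. rewrite Cmod_mult, Cmod_pow.
  apply Rle_trans with (Cmod (a (S k)) * r ^ k)%R.
  - apply Rmult_le_compat_l; [apply Cmod_ge_0|]. apply pow_incr. unfold r; lra.
  - right. unfold scal; simpl; unfold mult; simpl. field; lra. }
split; [exact H1|].
intros z Hz.
assert (K := is_Cseries_scal z _ _ (H1 z Hz)).
assert (L := proj1 (is_Cseries_shift _ _) (Hf z Hz)).
assert (E : f z - a O * z ^ 0 = z * CSeries (fun k => a (S k) * z ^ k)).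
{ apply (is_Cseries_unique _ _ _ L). refine (is_Cseries_eq _ _ _ _ _ (eq_refl _) K).
  intros k; simpl; ring. }
rewrite <- E. simpl; ring.
Qed.

Lemma disk_series_0 a f : disk_series a f -> f 0 = a O.
Proof.
intros H. destruct (disk_series_tail a f H) as [f1 [_ E]].
rewrite (E 0 unit_disk_0). ring.
Qed.

Lemma disk_series_drop_constant a f : disk_series a f ->
  disk_series (fun k => match k with O => 0 | S _ => a k end) (fun z => f z - a O).
Proof.
intros H z Hz. apply is_Cseries_shift.
refine (is_Cseries_eq _ _ _ _ _ _ (proj1 (is_Cseries_shift _ _) (H z Hz)));
  [reflexivity|simpl; ring].
Qed.

(** By induction on the order n of the zero, dividing out one factor z at a time. *)
Lemma disk_series_leading_term n : forall a f, disk_series a f ->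
  (forall k, (k < n)%nat -> a k = 0) ->
  exists M, (0 <= M)%R /\ forall z, (Cmod z <= 1 / 2)%R ->
    (Cmod (f z - a n * z ^ n) <= M * Cmod z ^ S n)%R.
Proof.
assert (Hdisk : forall z, (Cmod z <= 1/2)%R -> unit_disk z) by (unfold unit_disk; intros; lra).
induction n as [|n IH]; intros a f Hf Ha;
  destruct (disk_series_tail a f Hf) as [f1 [H1 E]].
- destruct (disk_series_abs _ _ (1/2) H1) as [B HB]; [lra|].
  assert (Hb : forall z, (Cmod z <= 1/2)%R -> (Cmod (f1 z) <= B)%R).
  { intros z Hz. refine (is_Cseries_le _ _ _ B (H1 z (Hdisk z Hz)) HB _).
    intros k. rewrite Cmod_mult, Cmod_pow. apply Rmult_le_compat_l; [apply Cmod_ge_0|].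
    apply pow_incr. split; [apply Cmod_ge_0|exact Hz]. }
  exists B. split.
  { eapply Rle_trans; [apply Cmod_ge_0 | apply (Hb 0)]. rewrite Cmod_0; lra. }
  intros z Hz. rewrite (E z (Hdisk z Hz)).
  replace (a O + z * f1 z - a O * z ^ 0) with (f1 z * z) by (simpl; ring).
  rewrite Cmod_mult. simpl pow. rewrite Rmult_1_r.
  apply Rmult_le_compat_r; [apply Cmod_ge_0 | apply Hb, Hz].
- destruct (IH _ _ H1) as [M [HM Hb]].
  { intros k Hk. apply Ha; lia. }
  exists M. split; [exact HM|].
  intros z Hz. rewrite (E z (Hdisk z Hz)), (Ha O) by lia.
  replace (0 + z * f1 z - a (S n) * z ^ S n) with (z * (f1 z - a (S n) * z ^ n)) by (simpl; ring).
  rewrite Cmod_mult.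
  replace (M * Cmod z ^ S (S n))%R with (Cmod z * (M * Cmod z ^ S n))%R by (simpl; ring).
  apply Rmult_le_compat_l; [apply Cmod_ge_0 | apply Hb, Hz].
Qed.

(** * Averages over roots of unity *)

(** The mean of the n + 1 values p(0), ..., p(n). *)
Definition Caverage (p : nat -> C) (n : nat) : C := / INR (S n) * Csum p n.

Lemma INR_S_neq_0 n : RtoC (INR (S n)) <> 0.
Proof. intros H. apply RtoC_inj in H. now apply (not_0_INR (S n)). Qed.

Lemma Caverage_1 n : Caverage (fun _ => 1) n = 1.
Proof.
unfold Caverage. replace (Csum (fun _ => RtoC 1) n) with (RtoC (INR (S n))).
- field. apply INR_S_neq_0.
- induction n as [|n IH]; [rewrite Csum_O; reflexivity|].
  rewrite Csum_Sn, <- IH, (S_INR (S n)), RtoC_plus. reflexivity.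
Qed.

Lemma Caverage_ext u v n : (forall k, u k = v k) -> Caverage u n = Caverage v n.
Proof. intros H. unfold Caverage. f_equal. apply sum_n_ext, H. Qed.

Lemma Caverage_Re_neg (d e : C) (u : nat -> C) n : (forall k, Re (d * u k - e) < 0)%R ->
  (Re (d * Caverage u n - e) < 0)%R.
Proof.
intros H.
assert (Hsum : (Re (d * Csum u n - INR (S n) * e) < 0)%R).
{ induction n as [|n IH].
  - rewrite Csum_O. simpl INR. rewrite Cmult_1_l. apply H.
  - rewrite Csum_Sn.
    replace (d * (Csum u n + u (S n)) - INR (S (S n)) * e)
      with ((d * Csum u n - INR (S n) * e) + (d * u (S n) - e)).
    + rewrite re_plus. specialize (H (S n)). lra.
    + rewrite (S_INR (S n)), RtoC_plus. ring. }
replace (d * Caverage u n - e) with (RtoC (/ INR (S n)) * (d * Csum u n - INR (S n) * e)).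
- rewrite re_scal_l. assert (0 < / INR (S n))%R by (apply Rinv_0_lt_compat, lt_0_INR; lia). nra.
- unfold Caverage. rewrite RtoC_inv by (apply not_0_INR; lia). field. apply INR_S_neq_0.
Qed.

Lemma disk_series_average (om : nat -> C) a f n :
  (forall k, Cmod (om k) = 1%R) -> disk_series a f ->
  disk_series (fun m => a m * Caverage (fun k => om k ^ m) n)
    (fun z => Caverage (fun k => f (om k * z)) n).
Proof.
intros Hom Hf z Hz.
assert (H1 : forall k, is_Cseries (fun m => a m * (om k * z) ^ m) (f (om k * z))).
{ intros k. apply Hf. unfold unit_disk. rewrite Cmod_mult, Hom, Rmult_1_l. exact Hz. }
assert (H2 : is_Cseries (fun m => a m * z ^ m * Csum (fun k => om k ^ m) n)
  (Csum (fun k => f (om k * z)) n)).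
{ induction n as [|n IH].
  - refine (is_Cseries_eq _ _ _ _ _ _ (H1 O)); [intros m|]; rewrite !Csum_O; [|reflexivity].
    rewrite Cpow_mult_l; ring.
  - refine (is_Cseries_eq _ _ _ _ _ _ (is_Cseries_plus _ _ _ _ IH (H1 (S n))));
      [intros m|]; rewrite !Csum_Sn; [|reflexivity].
    rewrite Cpow_mult_l; ring. }
refine (is_Cseries_eq _ _ _ _ _ _ (is_Cseries_scal (/ INR (S n)) _ _ H2)); [intros m|reflexivity].
unfold Caverage; ring.
Qed.

Definition unity_root (n : nat) : C := Cexp (0, 2 * PI / INR n)%R.

Lemma Cexp_imag_neq_1 t : (0 < t < 2 * PI)%R -> Cexp (0, t)%R <> 1.
Proof.
intros Ht H. apply (f_equal Re) in H. unfold Cexp in H; simpl in H.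
rewrite exp_0 in H.
(* Re exp(it) = 1 - 2 sin(t/2)^2 is less than 1. *)
replace t with (2 * (t / 2))%R in H by field. rewrite cos_2a_sin in H.
assert (0 < sin (t / 2))%R by (apply sin_gt_0; lra). nra.
Qed.

Lemma Cmod_unity_root n : Cmod (unity_root n) = 1%R.
Proof. unfold unity_root. rewrite Cmod_Cexp. apply exp_0. Qed.

Lemma unity_root_pow n m :
  unity_root n ^ m = Cexp (0, INR m * (2 * PI / INR n))%R.
Proof.
unfold unity_root. rewrite Cexp_pow. f_equal.
apply injective_projections; simpl; ring.
Qed.

Lemma unity_root_pow_n n : (0 < n)%nat -> unity_root n ^ n = 1.
Proof.
intros Hn. rewrite unity_root_pow.
replace (INR n * (2 * PI / INR n))%R with (2 * PI)%R by (field; apply not_0_INR; lia).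
unfold Cexp; simpl. rewrite exp_0, cos_2PI, sin_2PI.
apply injective_projections; simpl; ring.
Qed.

Lemma unity_root_pow_neq_1 n m : (0 < m < n)%nat -> unity_root n ^ m <> 1.
Proof.
intros Hm. rewrite unity_root_pow. apply Cexp_imag_neq_1.
assert (0 < INR m)%R by (apply lt_0_INR; lia).
assert (INR m < INR n)%R by (apply lt_INR; lia).
assert (HP := PI_RGT_0).
split.
- apply Rmult_lt_0_compat; [assumption|]. apply Rdiv_lt_0_compat; lra.
- replace (2 * PI)%R with (INR n * (2 * PI / INR n))%R at 2 by (field; lra).
  apply Rmult_lt_compat_r; [apply Rdiv_lt_0_compat; lra | assumption].
Qed.

Lemma Csum_geometric x n :
  (x - 1) * Csum (fun k => x ^ k) n = x ^ S n - 1.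
Proof.
induction n as [|n IH].
- rewrite Csum_O. simpl; ring.
- rewrite Csum_Sn, Cmult_plus_distr_l, IH. simpl; ring.
Qed.

Lemma Caverage_unity_root_0 n : Caverage (fun k => (unity_root (S n) ^ k) ^ 0) n = 1.
Proof. rewrite <- (Caverage_1 n). apply Caverage_ext. reflexivity. Qed.

Lemma Caverage_unity_root_n n : Caverage (fun k => (unity_root (S n) ^ k) ^ S n) n = 1.
Proof.
rewrite <- (Caverage_1 n). apply Caverage_ext. intros k.
rewrite <- Cpow_mult_r, Nat.mul_comm, Cpow_mult_r, unity_root_pow_n by lia.
apply Cpow_1_l.
Qed.

Lemma Caverage_unity_root_lt n m : (0 < m < S n)%nat ->
  Caverage (fun k => (unity_root (S n) ^ k) ^ m) n = 0.
Proof.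
intros Hm. rewrite (Caverage_ext _ (fun k => (unity_root (S n) ^ m) ^ k)).
2: { intros k. rewrite <- !Cpow_mult_r. f_equal. lia. }
assert (H := Csum_geometric (unity_root (S n) ^ m) n).
rewrite <- Cpow_mult_r, Nat.mul_comm, Cpow_mult_r, unity_root_pow_n, Cpow_1_l in H by lia.
assert (H1 := unity_root_pow_neq_1 (S n) m Hm).
unfold Caverage.
set (x := unity_root (S n) ^ m) in *.
set (s := Csum (fun k => x ^ k) n) in *.
assert (Hx : x - 1 <> 0) by (apply Cminus_eq_contra; exact H1).
replace s with (/ (x - 1) * ((x - 1) * s)) by (field; exact Hx).
rewrite H. ring.
Qed.

(** * The Schwarz lemma for zeros of higher order *)

Definition polar (r t : R) : C := (r * cos t, r * sin t)%R.

Lemma Cmod_polar r t : (0 <= r)%R -> Cmod (polar r t) = r.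
Proof.
intros Hr. unfold polar, Cmod; simpl.
replace (_ + _)%R with (r * r)%R; [apply sqrt_square, Hr|].
generalize (sin2_cos2 t); unfold Rsqr; intros H.
transitivity (r * r * (sin t * sin t + cos t * cos t))%R; [rewrite H; ring | ring].
Qed.

Lemma is_derive_polar_radial f l r t : cderiv f (polar r t) l ->
  is_derive (fun s => Re (f (polar s t))) r (Re (l * polar 1 t)).
Proof.
intros H. unfold polar. rewrite !Rmult_1_l.
apply (cderiv_curve f (fun s => s * cos t)%R (fun s => s * sin t)%R r).
- auto_derive; [trivial|ring].
- auto_derive; [trivial|ring].
- exact H.
Qed.

Lemma is_derive_polar_angular f l r t : cderiv f (polar r t) l ->
  is_derive (fun s => Re (f (polar r s))) t (- (r * Im (l * polar 1 t)))%R /\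
  is_derive (fun s => Im (f (polar r s))) t (r * Re (l * polar 1 t))%R.
Proof.
intros H.
destruct (cderiv_curve f (fun s => r * cos s)%R
  (fun s => r * sin s)%R t (- (r * sin t))%R (r * cos t)%R l) as [A B].
- auto_derive; [trivial|ring].
- auto_derive; [trivial|ring].
- exact H.
- split; unfold polar.
  + replace (- (r * Im (l * (1 * cos t, 1 * sin t)%R)))%R with (Re (l * (- (r * sin t), r * cos t)%R)); [exact A|].
    destruct l; simpl; ring.
  + replace (r * Re (l * (1 * cos t, 1 * sin t)%R))%R with (Im (l * (- (r * sin t), r * cos t)%R)); [exact B|].
    destruct l; simpl; ring.
Qed.

Lemma continuity_2d_polar f l r t : cderiv f (polar r t) l ->
  continuity_2d_pt (fun u v => Re (f (polar u v) * polar 1 v)) r t.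
Proof.
intros H. apply differentiable_continuity_pt.
apply cderiv_CR in H. destruct H as [HR HI].
assert (Hc := differentiable_pt_lim_comp_fct cos _ r t _ _ _ (derivable_pt_lim_cos t) (differentiable_pt_lim_snd r t)).
assert (Hs := differentiable_pt_lim_comp_fct sin _ r t _ _ _ (derivable_pt_lim_sin t) (differentiable_pt_lim_snd r t)).
assert (Hx := differentiable_pt_lim_mult_fct _ _ _ _ _ _ _ _ (differentiable_pt_lim_fst r t) Hc).
assert (Hy := differentiable_pt_lim_mult_fct _ _ _ _ _ _ _ _ (differentiable_pt_lim_fst r t) Hs).
assert (KR := differentiable_pt_lim_comp _ _ _ r t _ _ _ _ _ _ HR Hx Hy).
assert (KI := differentiable_pt_lim_comp _ _ _ r t _ _ _ _ _ _ HI Hx Hy).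
assert (Dn : derivable_pt_lim (fun s => - sin s)%R t (- cos t)%R).
{ apply is_derive_Reals. auto_derive; [trivial|ring]. }
assert (Hs' := differentiable_pt_lim_comp_fct _ _ r t _ _ _ Dn (differentiable_pt_lim_snd r t)).
assert (T1 := differentiable_pt_lim_mult_fct _ _ _ _ _ _ _ _ KR Hc).
assert (T2 := differentiable_pt_lim_mult_fct _ _ _ _ _ _ _ _ KI Hs').
assert (K := differentiable_pt_lim_comp _ _ _ r t _ _ _ _ _ _ (differentiable_pt_lim_Rplus _ _) T1 T2).
eexists; eexists. eapply differentiable_pt_lim_ext; [|exact K].
exists (mkposreal 1 Rlt_0_1). intros u v _ _. unfold polar; simpl. unfold Re, Im. ring.
Qed.

(** With D = h' e^(it) the radial derivative of h(r e^(it)) is D and the angular one is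
    i r D.  So the derivative of the mean of Re h is the integral of Re D, which is 1/r
    times the angular derivative of Im h, and Im h is periodic in t. *)
Lemma is_derive_circle_mean h h' r :
  (forall z, (0 < Cmod z < 1)%R -> cderiv h z (h' z) /\ exists l, cderiv h' z l) ->
  (0 < r < 1)%R ->
  is_derive (fun r => RInt (fun t => Re (h (polar r t))) 0 (2 * PI)) r 0.
Proof.
intros Hh Hr. assert (HP := PI_RGT_0).
assert (Hpol : forall r t, (0 < r < 1)%R -> (0 < Cmod (polar r t) < 1)%R).
{ intros r' t H'. rewrite Cmod_polar; lra. }
assert (Hloc : locally r (fun y => 0 < y < 1)%R).
{ apply (locally_interval _ r 0 1); simpl; tauto. }
assert (HD : forall u v, (0 < u < 1)%R ->
  Derive (fun z => Re (h (polar z v))) u = Re (h' (polar u v) * polar 1 v)).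
{ intros u v Hu. apply is_derive_unique, is_derive_polar_radial, Hh, Hpol, Hu. }
assert (E : RInt (fun t => Derive (fun u => Re (h (polar u t))) r) 0 (2 * PI) = 0%R).
{ apply is_RInt_unique.
  apply (is_RInt_ext (fun t => Re (h' (polar r t) * polar 1 t))).
  { intros t _. symmetry; apply HD, Hr. }
  replace 0%R with (minus (/ r * Im (h (polar r (2 * PI))))%R (/ r * Im (h (polar r 0)))%R) at 2.
  2: { unfold polar. rewrite cos_2PI, sin_2PI, cos_0, sin_0.
  apply (minus_eq_zero (G := R_AbelianGroup)). }
  apply (is_RInt_derive (V := R_CompleteNormedModule) (fun t => / r * Im (h (polar r t)))%R).
  - intros t _.
    replace (Re (h' (polar r t) * polar 1 t)) with (/ r * (r * Re (h' (polar r t) * polar 1 t)))%R by (field; lra).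
    apply (is_derive_scal (fun t => Im (h (polar r t)))).
    apply is_derive_polar_angular, Hh, Hpol, Hr.
  - intros t _. apply (ex_derive_continuous (K := R_AbsRing) (V := R_NormedModule)).
    destruct (proj2 (Hh _ (Hpol r t Hr))) as [l Hl].
    destruct (is_derive_polar_angular _ _ _ _ Hl) as [A B].
    apply (ex_derive_ext (fun s => Re (h' (polar r s)) * cos s - Im (h' (polar r s)) * sin s)%R).
    { intros s. unfold polar, Re, Im; simpl; ring. }
    apply (ex_derive_minus (K := R_AbsRing) (V := R_NormedModule)); apply ex_derive_mult.
    + eexists; exact A.
    + auto_derive; trivial.
    + eexists; exact B.
    + auto_derive; trivial. }
refine (eq_ind _ (fun l => is_derive _ r l) _ _ E).
apply (is_derive_RInt_param (fun r t => Re (h (polar r t)))).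
- revert Hloc; apply filter_imp. intros y Hy t _. eexists.
  exact (is_derive_polar_radial h _ y t (proj1 (Hh _ (Hpol y t Hy)))).
- intros t _. destruct (proj2 (Hh _ (Hpol r t Hr))) as [l Hl].
  eapply continuity_2d_pt_ext_loc; [|apply (continuity_2d_polar _ _ _ _ Hl)].
  destruct Hloc as [d Hd]. exists d. intros u v Hu _. symmetry; apply HD, Hd, Hu.
- revert Hloc; apply filter_imp. intros y Hy.
  apply (ex_RInt_continuous (V := R_CompleteNormedModule)). intros t _.
  apply (ex_derive_continuous (K := R_AbsRing) (V := R_NormedModule)).
  eexists. exact (proj1 (is_derive_polar_angular h _ y t (proj1 (Hh _ (Hpol y t Hy))))).
Qed.

Lemma circle_mean_const h h' s r :
  (forall z, (0 < Cmod z < 1)%R -> cderiv h z (h' z) /\ exists l, cderiv h' z l) ->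
  (0 < s < r)%R -> (r < 1)%R ->
  RInt (fun t => Re (h (polar s t))) 0 (2 * PI) = RInt (fun t => Re (h (polar r t))) 0 (2 * PI).
Proof.
intros Hh Hs Hr.
apply (eq_is_derive (V := R_NormedModule) (fun r => RInt
  (fun t => Re (h (polar r t))) 0 (2 * PI))); [|lra].
intros t Ht. apply (is_derive_circle_mean h h'); [exact Hh|lra].
Qed.

(** Rotate so that the leading coefficient is positive and apply [circle_mean_const] to
    W / z^n.  On small circles its mean is nearly |q|, on the circle of radius r it is
    at most r^(-n), and r may tend to 1. *)
Lemma Schwarz_order n (W W' : C -> C) (q : C) :
  (forall z, unit_disk z -> cderiv W z (W' z)) ->
  (forall z, unit_disk z -> exists l, cderiv W' z l) ->
  (forall z, unit_disk z -> (Cmod (W z) <= 1)%R) ->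
  (forall eps, (0 < eps)%R -> exists d, (0 < d)%R /\ forall z, (Cmod z < d)%R ->
     (Cmod (W z - q * z ^ n) <= eps * Cmod z ^ n)%R) ->
  (Cmod q <= 1)%R.
Proof.
intros HW HW' Hb Ha.
apply Rnot_lt_le; intros Hq. assert (HP := PI_RGT_0).
assert (Hq0 : q <> 0) by (apply Cmod_gt_0; lra).
(* The rotation that makes c q = |q|. *)
set (c := Cconj q / Cmod q).
assert (Hc : Cmod c = 1%R).
{ unfold c.
  rewrite Cmod_div, Cmod_conj, Cmod_R, Rabs_pos_eq
    by (try apply Cmod_ge_0; intros H; apply RtoC_inj in H; lra).
  field; lra. }
assert (Hcq : Re (c * q) = Cmod q).
{ replace (c * q) with (RtoC (Cmod q)); [reflexivity|]. unfold c.
  assert (E := Cmod2_conj q). rewrite RtoC_pow in E. 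
  replace (Cconj q / Cmod q * q) with ((q * Cconj q) / Cmod q)
    by (field; intros H; apply RtoC_inj in H; lra).
  rewrite <- E. field. intros H; apply RtoC_inj in H; lra. }
set (h := fun z => c * (W z * / z ^ n)).
set (h' := fun z => c * (W' z * / z ^ n + W z * (- / (z ^ n) ^ 2 * (INR n * z ^ pred n)))).
assert (Hh : forall z, (0 < Cmod z < 1)%R -> cderiv h z (h' z) /\ exists l, cderiv h' z l).
{ intros z [Hz0 Hz1]. assert (Hzn : z ^ n <> 0) by (apply Cpow_nz, Cmod_gt_0, Hz0).
  assert (D : cderiv (fun z => / z ^ n) z (- / (z ^ n) ^ 2 * (INR n * z ^ pred n))).
  { apply (cderiv_comp Cinv (fun z => z ^ n)); [apply cderiv_Cinv, Hzn | apply cderiv_pow]. }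
  split.
  - exact (cderiv_scal c _ z _ (cderiv_mult W _ z _ _ (HW z Hz1) D)).
  - destruct (HW' z Hz1) as [l Hl].
    assert (D2 := cderiv_scal (- (1)) _ z _ (cderiv_mult _ _ z _ _ D D)).
    apply (cderiv_ext _ (fun z => - / (z ^ n) ^ 2) z _ (Cmod z) Hz0) in D2.
    + eexists. exact (cderiv_scal c _ z _ (cderiv_plus _ _ z _ _ (cderiv_mult _ _ z _ _ Hl D)
        (cderiv_mult _ _ z _ _ (HW z Hz1) (cderiv_mult _ _ z _ _ D2
          (cderiv_scal (INR n) _ z _ (cderiv_pow (pred n) z)))))).
    + intros w Hw. assert (Hw0 : w <> 0).
      { intros ->. rewrite <- (Cmod_opp (0 - z)) in Hw. replace (- (0 - z)) with z in Hw by ring.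
        lra. }
      assert (Hwn := Cpow_nz w n Hw0). field. exact Hwn. }
set (eps := ((Cmod q - 1) / 2)%R). assert (Heps : (0 < eps)%R) by (unfold eps; lra).
destruct (Ha eps Heps) as [d [Hd Hclose]].
set (m := (Cmod q - eps)%R). assert (Hm : (1 < m)%R) by (unfold m, eps; lra).
(* Compare the mean of Re h on a small circle with that on the circle of radius r. *)
assert (Hkey : forall r, (0 < r < 1)%R -> (m * r ^ n <= 1)%R).
{ intros r Hr. set (s := (Rmin d r / 2)%R).
  assert (Hs : (0 < s)%R) by (unfold s; assert (0 < Rmin d r)%R by (apply Rmin_pos; lra); lra).
  assert (Hsd : (s < d)%R) by (unfold s; assert (T := Rmin_l d r); lra).
  assert (Hsr : (s < r)%R) by (unfold s; assert (T := Rmin_r d r); lra).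
  assert (Hex : forall r, (0 < r < 1)%R -> ex_RInt (fun t => Re (h (polar r t))) 0 (2 * PI)).
  { intros y Hy. apply (ex_RInt_continuous (V := R_CompleteNormedModule)). intros t _.
    apply (ex_derive_continuous (K := R_AbsRing) (V := R_NormedModule)).
    assert (Hy' : (0 < Cmod (polar y t) < 1)%R) by (rewrite Cmod_polar; lra).
    eexists. exact (proj1 (is_derive_polar_angular h _ y t (proj1 (Hh _ Hy')))). }
  assert (L : (2 * PI * m <= RInt (fun t => Re (h (polar s t))) 0 (2 * PI))%R).
  { replace (2 * PI * m)%R with (RInt (fun _ => m) 0 (2 * PI)).
    2: { rewrite RInt_const. unfold scal; simpl; unfold mult; simpl. ring. }
    apply RInt_le; [lra | apply ex_RInt_const | apply Hex; lra |].
    intros t _. set (z := polar s t).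
    assert (Hz : Cmod z = s) by (apply Cmod_polar; lra).
    assert (Hzn : z ^ n <> 0) by (apply Cpow_nz, Cmod_gt_0; lra).
    replace (h z) with (c * q + c * ((W z - q * z ^ n) * / z ^ n)) by (unfold h; field; exact Hzn).
    rewrite re_plus, Hcq.
    assert (B : (Rabs (Re (c * ((W z - q * z ^ n) * / z ^ n))) <= eps)%R).
    { eapply Rle_trans; [apply re_le_Cmod|].
      rewrite !Cmod_mult, Hc, Cmod_inv, Cmod_pow, Hz by exact Hzn.
      assert (Q := Hclose z ltac:(lra)). rewrite Hz in Q.
      assert (Hp : (0 < s ^ n)%R) by (apply pow_lt, Hs).
      apply Rmult_le_reg_r with (s ^ n)%R; [exact Hp|].
      replace (1 * (Cmod (W z - q * z ^ n) * / s ^ n) * s ^ n)%R with (Cmod (W z - q * z ^ n))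
        by (field; lra).
      exact Q. }
    apply Rabs_le_between in B. unfold m. lra. }
  assert (U : (RInt (fun t => Re (h (polar r t))) 0 (2 * PI) <= 2 * PI * / r ^ n)%R).
  { replace (2 * PI * / r ^ n)%R with (RInt (fun _ => / r ^ n)%R 0 (2 * PI)).
    2: { rewrite RInt_const. unfold scal; simpl; unfold mult; simpl. ring. }
    apply RInt_le; [lra | apply Hex; lra | apply ex_RInt_const |].
    intros t _. set (z := polar r t).
    assert (Hz : Cmod z = r) by (apply Cmod_polar; lra).
    assert (Hzn : z ^ n <> 0) by (apply Cpow_nz, Cmod_gt_0; lra).
    eapply Rle_trans; [apply Rle_abs|]. eapply Rle_trans; [apply re_le_Cmod|].
    unfold h. rewrite !Cmod_mult, Hc, Cmod_inv, Cmod_pow, Hz by exact Hzn.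
    rewrite Rmult_1_l. rewrite <- (Rmult_1_l (/ r ^ n)) at 2.
    apply Rmult_le_compat_r; [left; apply Rinv_0_lt_compat, pow_lt; lra|].
    apply Hb. unfold unit_disk; lra. }
  rewrite (circle_mean_const h h' s r Hh) in L by lra.
  assert (Hrn : (0 < r ^ n)%R) by (apply pow_lt; lra).
  apply Rmult_le_reg_r with (/ r ^ n)%R; [apply Rinv_0_lt_compat, Hrn|].
  replace (m * r ^ n * / r ^ n)%R with m by (field; lra). rewrite Rmult_1_l.
  apply Rmult_le_reg_l with (2 * PI)%R; lra. }
(* Since m > 1, continuity of m r^n at r = 1 contradicts [Hkey]. *)
assert (Hcont : continuous (fun r => m * r ^ n)%R 1%R).
{ apply (ex_derive_continuous (K := R_AbsRing) (V := R_NormedModule)). auto_derive; trivial. }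
destruct (Hcont (fun y => 1 < y)%R) as [e He].
{ apply (open_gt 1). rewrite pow1. lra. }
set (x := Rmin (e / 2) (1 / 2)). assert (He0 := cond_pos e).
assert (Hx1 : (x <= e / 2)%R) by apply Rmin_l. assert (Hx2 : (x <= 1 / 2)%R) by apply Rmin_r.
assert (Hx0 : (0 < x)%R) by (apply Rmin_pos; lra).
assert (T : (1 < m * (1 - x) ^ n)%R).
{ apply He. unfold ball; simpl; unfold AbsRing_ball, abs, minus, plus, opp; simpl.
  replace (1 - x + - (1))%R with (- x)%R by ring. rewrite Rabs_Ropp, Rabs_pos_eq; lra. }
specialize (Hkey (1 - x)%R). lra.
Qed.

(** * Convexity of the image of the unit disk under the exponential *)

(** Along the circle w(s) of radius r < 1 that touches the unit circle from inside at
    zeta = e^(it), the left-hand side is the component of exp(w(s) - zeta) in the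
    direction zeta.  Its derivative has the sign of - sin(g(s)), where the tangent
    angle g(s) = s + r (sin(t + s) - sin t) increases from 0 to 2 pi since r < 1.  So
    the component first decreases and then increases back to its initial value
    cos t. *)
Lemma exp_circle_support t s r : (0 < r < 1)%R -> (0 < s < 2 * PI)%R ->
  (exp (r * (cos (t + s) - cos t)) * cos (r * (sin (t + s) - sin t) - t) < cos t)%R.
Proof.
intros Hr Hs. assert (HP := PI_RGT_0).
set (psi := fun u => (exp (r * (cos (t + u) - cos t)) * cos (r * (sin (t + u) - sin t) - t))%R).
set (g := fun u => (u + r * (sin (t + u) - sin t))%R).
assert (Dpsi : forall u, is_derive psi u (- (r * exp (r * (cos (t + u) - cos t)) * sin (g u)))%R).
{ intros u. unfold psi. auto_derive; [trivial|].
  replace (g u) with ((t + u) + (r * (sin (t + u) - sin t) - t))%R by (unfold g; ring).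
  rewrite (sin_plus (t + u)). unfold Rminus. ring. }
assert (Dg : forall u, is_derive g u (1 + r * cos (t + u))%R).
{ intros u. unfold g. auto_derive; [trivial|ring]. }
assert (Hg : forall u v, (u < v)%R -> (g u < g v)%R).
{ intros u v Huv.
  destruct (MVT_gen g u v (fun u => 1 + r * cos (t + u))%R) as [c [_ Hc]].
  - intros; apply Dg.
  - intros; apply continuity_pt_filterlim, (ex_derive_continuous (K := R_AbsRing) (V := R_NormedModule)). eexists; apply Dg.
  - assert (B := COS_bound (t + c)). assert (0 < (1 + r * cos (t + c)) * (v - u))%R; [|lra].
    apply Rmult_lt_0_compat; nra. }
assert (Hmvt : forall u v, (u < v)%R -> exists c, (u < c < v)%R /\
  (psi v - psi u = - (r * exp (r * (cos (t + c) - cos t)) * sin (g c)) * (v - u))%R).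
{ intros u v Huv.
  destruct (MVT_cor2 psi
    (fun c => - (r * exp (r * (cos (t + c) - cos t)) * sin (g c)))%R u v Huv) as [c [H1 H2]].
  - intros; apply is_derive_Reals, Dpsi.
  - exists c; split; assumption. }
assert (G0 : g 0%R = 0%R) by (unfold g; rewrite Rplus_0_r; ring).
assert (G1 : g (2 * PI)%R = (2 * PI)%R).
{ unfold g. rewrite sin_plus, cos_2PI, sin_2PI. ring. }
assert (P0 : psi 0%R = cos t).
{ unfold psi. rewrite Rplus_0_r. replace (r * (cos t - cos t))%R with 0%R by ring.
  replace (r * (sin t - sin t) - t)%R with (- t)%R by ring. rewrite exp_0, cos_neg. ring. }
assert (P1 : psi (2 * PI)%R = cos t).
{ rewrite <- P0. unfold psi. rewrite Rplus_0_r, cos_plus, sin_plus, cos_2PI, sin_2PI.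
  f_equal; f_equal; ring. }
change (psi s < cos t)%R.
destruct (Rle_lt_dec (g s) PI) as [Hle|Hlt].
- destruct (Hmvt 0%R s (proj1 Hs)) as [c [Hc E]].
  assert (A1 := Hg 0%R c (proj1 Hc)). assert (A2 := Hg c s (proj2 Hc)).
  assert (S : (0 < sin (g c))%R) by (apply sin_gt_0; lra).
  assert (X := exp_pos (r * (cos (t + c) - cos t))).
  assert (0 < r * exp (r * (cos (t + c) - cos t)) * sin (g c) * (s - 0))%R by
    (repeat apply Rmult_lt_0_compat; lra).
  lra.
- destruct (Hmvt s (2 * PI)%R (proj2 Hs)) as [c [Hc E]].
  assert (A1 := Hg s c (proj1 Hc)). assert (A2 := Hg c (2 * PI)%R (proj2 Hc)).
  assert (S : (sin (g c) < 0)%R) by (apply sin_lt_0; lra).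
  assert (X := exp_pos (r * (cos (t + c) - cos t))).
  assert (0 < r * exp (r * (cos (t + c) - cos t)) * (- sin (g c)) * (2 * PI - s))%R by
    (repeat apply Rmult_lt_0_compat; lra).
  lra.
Qed.

Lemma Re_conj_polar_Cexp_minus_1 t z :
  Re (Cconj (polar 1 t) * (Cexp z - 1)) = (exp (Re z) * cos (Im z - t) - cos t)%R.
Proof.
unfold polar, Cexp; simpl. rewrite cos_minus. ring.
Qed.

(** The image of the open disk lies strictly on one side of the tangent at exp(zeta), with
    zeta = e^(it), after division by exp(zeta).  Every point w of the disk is on a
    circle of radius less than 1 touching the unit circle at zeta, and
    [exp_circle_support] applies. *)
Lemma exp_disk_support w t : (Cmod w < 1)%R ->
  (Re (Cconj (polar 1 t) * (Cexp (w - polar 1 t) - 1)) < 0)%R.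
Proof.
intros Hw.
(* w = zeta (1 + y), so the disk becomes |1 + y| < 1 with zeta moved to y = 0. *)
set (y := Cconj (polar 1 t) * w - 1).
assert (Ht : (sin t * sin t + cos t * cos t = 1)%R) by (generalize (sin2_cos2 t); unfold Rsqr; lra).
assert (Ew : w = polar 1 t * (1 + y)).
{ unfold y. replace (1 + (Cconj (polar 1 t) * w - 1)) with (Cconj (polar 1 t) * w) by ring.
  rewrite Cmult_assoc. replace (polar 1 t * Cconj (polar 1 t)) with (RtoC 1); [ring|].
  apply injective_projections; unfold polar; simpl; lra. }
destruct y as [a b] eqn:Ey. clear y Ey.
assert (Hm : ((1 + a) * (1 + a) + b * b < 1)%R).
{ assert (M : (Cmod (1 + (a, b)) < 1)%R).
  { rewrite Ew, Cmod_mult, Cmod_polar, Rmult_1_l in Hw by lra. exact Hw. }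
  assert (Q := Cmod2_alt (1 + (a, b))). simpl in Q. assert (N := Cmod_ge_0 (1 + (a, b))). nra. }
assert (Ha : (a < 0)%R) by nra.
(* The radius of the circle through y = a + i b touching the disk |1 + y| < 1 at 0. *)
set (r := ((a * a + b * b) / (- 2 * a))%R).
assert (Er : (2 * r * a + (a * a + b * b) = 0)%R) by (unfold r; field; lra).
assert (Hr : (0 < r < 1)%R).
{ unfold r; split.
  - apply Rdiv_lt_0_compat; nra.
  - apply Rmult_lt_reg_r with (- 2 * a)%R; [lra|]. unfold Rdiv. rewrite Rmult_assoc, Rinv_l by lra.
    nra. }
destruct (unit_circle_angle (1 + a / r) (b / r)) as [s [Hs [Hc Hsn]]].
{ replace ((1 + a / r) * (1 + a / r) + b / r * (b / r))%R with
   (1 + (2 * r * a + (a * a + b * b)) / (r * r))%R by (field; lra).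
  rewrite Er. field; lra. }
assert (Hs0 : s <> 0%R).
{ intros ->. rewrite cos_0 in Hc. assert (a / r = 0)%R by lra.
  assert (a = (a / r) * r)%R by (field; lra). nra. }
assert (K := exp_circle_support t s r Hr ltac:(destruct Hs; lra)).
assert (Ea : (a = r * (cos s - 1))%R) by (rewrite Hc; field; lra).
assert (Eb : (b = r * sin s)%R) by (rewrite Hsn; field; lra).
rewrite Ew, Re_conj_polar_Cexp_minus_1.
match goal with |- (exp ?x * cos (?y - t) - _ < 0)%R =>
  replace x with (r * (cos (t + s) - cos t))%R;
  [replace y with (r * (sin (t + s) - sin t))%R; [lra|]|] end.
- rewrite Ea, Eb, sin_plus. unfold polar; simpl; ring.
- rewrite Ea, Eb, cos_plus. unfold polar; simpl; ring.
Qed.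

Lemma Cexp_disk_Re_pos w : (Cmod w < 1)%R -> (0 < Re (Cexp w))%R.
Proof.
intros Hw. assert (M := Rmax_Cmod w). assert (M2 := Rmax_r (Rabs (fst w)) (Rabs (snd w))).
assert (HP := PI2_1).
assert (B : (Rabs (Im w) < 1)%R) by (unfold Im; lra).
apply Rabs_lt_between in B.
unfold Cexp; simpl. replace (_ - _)%R with (exp (Re w) * cos (Im w))%R by ring.
apply Rmult_lt_0_compat; [apply exp_pos | apply cos_gt_0; lra].
Qed.

(** The points exp(rho zeta) with rho = 1 + x lie on the other side of the tangent at
    exp(zeta), as long as the argument of exp(x zeta) stays below pi/2: the
    derivative of the left-hand side in x is Re exp(x zeta). *)
Lemma exp_ray_support t x : (0 <= x)%R -> (Rabs (x * sin t) < PI / 2)%R ->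
  (0 <= Re (Cconj (polar 1 t) * (Cexp (x * polar 1 t) - 1)))%R.
Proof.
intros Hx Hb.
set (phi := fun d => (exp (d * cos t) * cos (d * sin t - t))%R).
assert (E : Re (Cconj (polar 1 t) * (Cexp (x * polar 1 t) - 1)) = (phi x - phi 0)%R).
{ rewrite Re_conj_polar_Cexp_minus_1. unfold phi.
  rewrite !Rmult_0_l, exp_0, Rminus_0_l, cos_neg.
  unfold polar; simpl. rewrite !Rmult_1_l, !Rmult_0_l, Rminus_0_r, Rplus_0_r. ring. }
rewrite E.
destruct (MVT_gen phi 0 x (fun d => exp (d * cos t) * cos (d * sin t))%R) as [c [Hc Ec]].
- intros d _. unfold phi. auto_derive; [trivial|].
  replace (d * sin t)%R with (t + (d * sin t - t))%R at 3 by ring. rewrite (cos_plus t).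
  unfold Rminus. ring.
- intros d _.
  apply continuity_pt_filterlim, (ex_derive_continuous (K := R_AbsRing) (V := R_NormedModule)).
  unfold phi. auto_derive; trivial.
- rewrite Ec, Rminus_0_r. rewrite Rmin_left, Rmax_right in Hc by exact Hx.
  apply Rmult_le_pos; [|exact Hx]. apply Rmult_le_pos; [left; apply exp_pos|].
  assert (D : (Rabs (c * sin t) <= Rabs (x * sin t))%R).
  { rewrite !Rabs_mult, !(Rabs_pos_eq x), !(Rabs_pos_eq c) by lra.
    apply Rmult_le_compat_r; [apply Rabs_pos | lra]. }
  assert (F : (Rabs (c * sin t) < PI / 2)%R) by lra.
  apply Rabs_lt_between in F. apply cos_ge_0; lra.
Qed.

(** If the average were exp(rho zeta) with |zeta| = 1 and rho >= 1, the tangent at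
    exp(zeta) would separate it from all the averaged points. *)
Lemma exp_disk_convex (w : nat -> C) n : (forall k, Cmod (w k) < 1)%R ->
  (0 < Re (Caverage (fun k => Cexp (w k)) n))%R /\
  (Cmod (Clog (Caverage (fun k => Cexp (w k)) n)) < 1)%R.
Proof.
intros Hw. set (A := Caverage (fun k => Cexp (w k)) n).
assert (HA : (0 < Re A)%R).
{ assert (K : (Re (- (1) * A - 0) < 0)%R).
  { apply Caverage_Re_neg. intros k. assert (P := Cexp_disk_Re_pos (w k) (Hw k)).
    replace (- (1) * Cexp (w k) - 0) with (- Cexp (w k)) by ring. rewrite re_opp. lra. }
  replace (- (1) * A - 0) with (- A) in K by ring. rewrite re_opp in K. lra. }
split; [exact HA|].
apply Rnot_le_lt; intros Hge.
assert (EA := Cexp_Clog A HA).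
set (L := Clog A) in *. set (rho := Cmod L) in *.
assert (HIm : (Rabs (Im L) < PI / 2)%R).
{ change (Im L) with (atan (Im A / Re A)). assert (B := atan_bound (Im A / Re A)).
  apply Rabs_def1; lra. }
clearbody L.
assert (Hrho : (rho * rho = Re L * Re L + Im L * Im L)%R).
{ assert (Q := Cmod2_alt L). fold rho in Q. lra. }
destruct (unit_circle_angle (Re L / rho) (Im L / rho)) as [t [_ [Hc Hs]]].
{ replace (Re L / rho * (Re L / rho) + Im L / rho * (Im L / rho))%R
    with ((Re L * Re L + Im L * Im L) / (rho * rho))%R by (field; lra).
  rewrite <- Hrho. field; lra. }
assert (EL : L = rho * polar 1 t).
{ destruct L as [x y]. clearbody rho. simpl in Hc, Hs.
  apply injective_projections; unfold polar; simpl; rewrite Hc, Hs; field; lra. }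
set (zt := polar 1 t) in *.
assert (Hneg : (Re (Cconj zt * Cexp (- zt) * A - Cconj zt) < 0)%R).
{ apply Caverage_Re_neg. intros k.
  replace (Cconj zt * Cexp (- zt) * Cexp (w k) - Cconj zt) with (Cconj zt * (Cexp (w k - zt) - 1)).
  - apply exp_disk_support, Hw.
  - unfold Cminus at 2. rewrite Cexp_plus. ring. }
(* The hypothesis of [exp_ray_support] holds because Im (Clog A) is an arctangent. *)
assert (Hpos : (0 <= Re (Cconj zt * (Cexp (RtoC (rho - 1) * zt) - 1)))%R).
{ apply exp_ray_support; [lra|].
  eapply Rle_lt_trans; [|exact HIm].
  rewrite Hs. rewrite Rabs_mult. unfold Rdiv.
  rewrite Rabs_mult, Rabs_inv, !(Rabs_pos_eq rho) by lra.
  rewrite Rabs_pos_eq by lra.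
  replace ((rho - 1) * (Rabs (Im L) * / rho))%R with (Rabs (Im L) - Rabs (Im L) / rho)%R
    by (field; lra).
  assert (0 <= Rabs (Im L) / rho)%R; [|lra].
  apply Rmult_le_pos; [apply Rabs_pos | left; apply Rinv_0_lt_compat; lra]. }
replace (Cconj zt * (Cexp (RtoC (rho - 1) * zt) - 1)) with (Cconj zt * Cexp (- zt) * A - Cconj zt) in Hpos; [lra|].
rewrite <- EA, EL, RtoC_minus.
replace ((rho - 1) * zt) with (- zt + rho * zt) by ring. rewrite Cexp_plus. ring.
Qed.

(** * The coefficient bound *)

(** Near 1 the logarithm is u - 1 up to o(|u - 1|), and |g - 1| = O(|z|^n). *)
Lemma Clog_leading_term (g : C -> C) q n : (0 < n)%nat ->
  (exists M, (0 <= M)%R /\ forall z, (Cmod z <= 1 / 2)%R ->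
    (Cmod (g z - 1 - q * z ^ n) <= M * Cmod z ^ S n)%R) ->
  forall eps, (0 < eps)%R -> exists d, (0 < d)%R /\ forall z, (Cmod z < d)%R ->
     (Cmod (Clog (g z) - q * z ^ n) <= eps * Cmod z ^ n)%R.
Proof.
intros Hn [M [HM Hg]] eps Heps.
set (K := (Cmod q + M)%R). assert (HK : (0 <= K)%R) by (unfold K; assert (T := Cmod_ge_0 q); lra).
assert (H1 : cderiv Clog 1 (/ 1)) by (apply cderiv_Clog; simpl; lra).
destruct (H1 (eps / (2 * (K + 1)))%R) as [d1 [Hd1 Hlog]].
{ apply Rdiv_lt_0_compat; lra. }
set (d := Rmin (1 / 2) (Rmin (eps / (2 * (M + 1))) (d1 / (K + 1)))).
assert (D1 : (d <= 1 / 2)%R) by apply Rmin_l.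
assert (D2 : (d <= eps / (2 * (M + 1)))%R) by (eapply Rle_trans; [apply Rmin_r|apply Rmin_l]).
assert (D3 : (d <= d1 / (K + 1))%R) by (eapply Rle_trans; [apply Rmin_r|apply Rmin_r]).
exists d. split.
{ repeat apply Rmin_pos; [lra | apply Rdiv_lt_0_compat; lra | apply Rdiv_lt_0_compat; lra]. }
intros z Hz. assert (Hz0 := Cmod_ge_0 z).
specialize (Hg z ltac:(lra)).
set (x := Cmod z) in *.
assert (Hxn : (0 <= x ^ n)%R) by (apply pow_le, Hz0).
assert (Hxle : (x ^ n <= x)%R).
{ destruct n as [|n]; [lia|]. simpl. assert (x ^ n <= 1)%R.
  { rewrite <- (pow1 n). apply pow_incr. lra. } nra. }
assert (HG : (Cmod (g z - 1) <= K * x ^ n)%R).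
{ replace (g z - 1) with (q * z ^ n + (g z - 1 - q * z ^ n)) by ring.
  eapply Rle_trans; [apply Cmod_triangle|]. rewrite Cmod_mult, Cmod_pow. fold x.
  unfold K. assert (x ^ S n <= x ^ n)%R by (simpl; nra). nra. }
assert (HG1 : (Cmod (g z - 1) < d1)%R).
{ eapply Rle_lt_trans; [exact HG|].
  apply Rle_lt_trans with ((K + 1) * x)%R; [nra|].
  apply Rlt_le_trans with ((K + 1) * (d1 / (K + 1)))%R; [apply Rmult_lt_compat_l; lra|].
  right; field; lra. }
specialize (Hlog (g z) HG1). rewrite Clog_1 in Hlog.
replace (Clog (g z) - q * z ^ n) with
  ((Clog (g z) - 0 - / 1 * (g z - 1)) + (g z - 1 - q * z ^ n)) by (field; apply C1_nz).
eapply Rle_trans; [apply Cmod_triangle|].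
replace (eps * x ^ n)%R with (eps / 2 * x ^ n + eps / 2 * x ^ n)%R by field.
apply Rplus_le_compat.
- eapply Rle_trans; [exact Hlog|].
  apply Rle_trans with (eps / (2 * (K + 1)) * ((K + 1) * x ^ n))%R.
  + apply Rmult_le_compat_l; [left; apply Rdiv_lt_0_compat; lra|]. nra.
  + right; field; lra.
- eapply Rle_trans; [exact Hg|]. simpl.
  replace (M * (x * x ^ n))%R with ((M * x) * x ^ n)%R by ring.
  apply Rmult_le_compat_r; [exact Hxn|].
  apply Rle_trans with ((M + 1) * (eps / (2 * (M + 1))))%R.
  + apply Rmult_le_compat; lra.
  + right; field; lra.
Qed.

(** Rogosinski's theorem for subordination to the exponential.  The
    normalisation w(0) = 0 appears as [p O = 1]. *)
Lemma coeff_bound_of_exp_subordinate p P (w : C -> C) n : disk_series p P -> p O = 1 ->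
  (forall z, unit_disk z -> P z = Cexp (w z)) ->
  (forall z, unit_disk z -> unit_disk (w z)) -> (0 < n)%nat -> (Cmod (p n) <= 1)%R.
Proof.
(* [Caverage] over the indices 0, ..., m takes n = m + 1 terms. *)
intros HP Hp0 HPw Hw Hn. destruct n as [|m]; [lia|]. clear Hn. set (n := S m).
set (om := fun k => unity_root n ^ k).
assert (Hom : forall k, Cmod (om k) = 1%R).
{ intros k. unfold om. rewrite Cmod_pow, Cmod_unity_root. apply pow1. }
assert (HG := disk_series_average om p P m Hom HP).
set (g := fun j => p j * Caverage (fun k => om k ^ j) m) in HG.
set (G := fun z => Caverage (fun k => P (om k * z)) m) in HG.
assert (Hg0 : g O = 1).
{ unfold g, om, n. rewrite Caverage_unity_root_0, Hp0. ring. }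
assert (Hgn : g n = p n).
{ unfold g, om, n. rewrite Caverage_unity_root_n. ring. }
assert (Hgj : forall j, (0 < j < n)%nat -> g j = 0).
{ intros j Hj. unfold g, om, n. rewrite Caverage_unity_root_lt by exact Hj. ring. }
assert (HGw : forall z, unit_disk z -> (0 < Re (G z))%R /\ (Cmod (Clog (G z)) < 1)%R).
{ intros z Hz.
  assert (Hk : forall k, unit_disk (om k * z)).
  { intros k. unfold unit_disk. rewrite Cmod_mult, Hom, Rmult_1_l. exact Hz. }
  replace (G z) with (Caverage (fun k => Cexp (w (om k * z))) m).
  - apply exp_disk_convex. intros k. apply Hw, Hk.
  - apply Caverage_ext. intros k. symmetry; apply HPw, Hk. }
destruct (disk_series_derive g G HG) as [G1 [HG1 DG]].
destruct (disk_series_derive _ G1 HG1) as [G2 [_ DG1]].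
assert (Hnz : forall z, unit_disk z -> G z <> 0).
{ intros z Hz E. apply HGw in Hz. rewrite E in Hz. simpl in Hz. lra. }
apply (Schwarz_order n (fun z => Clog (G z)) (fun z => / G z * G1 z)).
- intros z Hz. apply (cderiv_comp Clog G); [apply cderiv_Clog, HGw, Hz | apply DG, Hz].
- intros z Hz. eexists. apply cderiv_mult; [|apply DG1, Hz].
  apply (cderiv_comp Cinv G); [apply cderiv_Cinv, Hnz, Hz | apply DG, Hz].
- intros z Hz. left. apply HGw, Hz.
- apply Clog_leading_term; [unfold n; lia|].
  destruct (disk_series_leading_term n _ _ (disk_series_drop_constant g G HG)) as [M [HM B]].
  { intros [|k] Hk; [reflexivity | apply Hgj; lia]. }
  exists M. split; [exact HM|]. intros z Hz. specialize (B z Hz).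
  rewrite Hg0 in B. unfold n in B at 1. fold n in B. rewrite Hgn in B. exact B.
Qed.

Lemma quot_id_Cexp (f L : C -> C) : f 0 = 0 ->
  (forall z, unit_disk z -> Cexp (L z) = quot_id f z) ->
  forall z, unit_disk z -> f z = z * Cexp (L z).
Proof.
intros H0 HL z Hz. rewrite HL by exact Hz. unfold quot_id.
destruct (Ceq_dec z 0) as [->|Hz0]; [rewrite H0; ring | field; exact Hz0].
Qed.

Lemma cderiv_id_Cexp (L : C -> C) z l : cderiv L z l ->
  cderiv (fun w => w * Cexp (L w)) z (Cexp (L z) * (1 + z * l)).
Proof.
intros H. eapply cderiv_eq; [|exact (cderiv_mult _ _ z _ _ (cderiv_id z)
  (cderiv_comp Cexp L z _ _ (cderiv_Cexp (L z)) H))].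
simpl; ring.
Qed.

(** The logarithmic derivative of z exp(L); the value at 0 agrees with the one assigned
    to the removable singularity. *)
Lemma zderiv_quot_id_Cexp (f L : C -> C) z l :
  (forall w, unit_disk w -> f w = w * Cexp (L w)) -> unit_disk z -> cderiv L z l ->
  zderiv_quot f z = 1 + z * l.
Proof.
intros Hf Hz HL. unfold zderiv_quot.
destruct (Ceq_dec z 0) as [->|Hz0]; [ring|].
destruct (unit_disk_open z Hz) as [r [Hr Hball]].
rewrite (cderiv_unique f z (Cexp (L z) * (1 + z * l))).
- rewrite (Hf z Hz). field. split; [apply Cexp_neq_0 | exact Hz0].
- apply (cderiv_ext (fun w => w * Cexp (L w)) f z _ r Hr).
  + intros w Hw. symmetry; apply Hf, Hball, Hw.
  + apply cderiv_id_Cexp, HL.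
Qed.

Lemma log_coeff_bound f gamma n : class_S_e_star f -> is_log_coeffs f gamma -> (0 < n)%nat ->
  (Cmod (gamma n) <= 1 / (2 * INR n))%R.
Proof.
intros [[_ [_ [Hf0 _]]] [w [_ [Hw [Hw0 Hsub]]]]] [L [[_ [HL0 HL]] Hser]] Hn.
assert (Hf := quot_id_Cexp f L Hf0 HL).
set (a := fun k => match k with O => 0 | S _ => 2 * gamma k end : C).
assert (Ha : disk_series a L).
{ intros z Hz. destruct (Hser z Hz) as [s [Hs E]]. apply is_Cseries_shift.
  refine (is_Cseries_eq _ _ _ _ _ _ (is_Cseries_scal 2 _ _ Hs)).
  - intros k; simpl; ring.
  - rewrite E; simpl; ring. }
destruct (disk_series_derive a L Ha) as [L' [Ha' DL]].
set (p := fun k => match k with O => 1 | S j => Cderive_coeff a j end : C).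
assert (Hp : disk_series p (fun z => 1 + z * L' z)).
{ intros z Hz. apply is_Cseries_shift.
  refine (is_Cseries_eq _ _ _ _ _ _ (is_Cseries_scal z _ _ (Ha' z Hz))).
  - intros k; simpl; ring.
  - simpl; ring. }
assert (B : (Cmod (p n) <= 1)%R).
{ apply (coeff_bound_of_exp_subordinate p _ w n Hp); [reflexivity | | exact Hw | exact Hn].
  intros z Hz. rewrite <- (Hsub z Hz). symmetry. apply (zderiv_quot_id_Cexp f L); auto. }
destruct n as [|n]; [lia|].
unfold p, Cderive_coeff, a in B.
rewrite !Cmod_mult, !Cmod_R, !Rabs_pos_eq in B by (try apply pos_INR; lra).
assert (HI : (0 < INR (S n))%R) by (apply lt_0_INR; lia).
apply Rmult_le_reg_l with (2 * INR (S n))%R; [lra|].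
replace (2 * INR (S n) * (1 / (2 * INR (S n))))%R with 1%R by (field; lra). lra.
Qed.

(** * Univalence of starlike functions *)

(** On the segment from z to w the component of F in the direction w - z is strictly
    increasing, because its derivative is |w - z|^2 Re F'. *)
Lemma Noshiro_Warschawski_half_plane (F F' : C -> C) :
  (forall z, (Re z < 0)%R -> cderiv F z (F' z)) ->
  (forall z, (Re z < 0)%R -> (0 < Re (F' z))%R) ->
  forall z w, (Re z < 0)%R -> (Re w < 0)%R -> F z = F w -> z = w.
Proof.
intros HF HF' [x1 y1] [x2 y2]; simpl; intros H1 H2 E.
destruct (Ceq_dec (x1, y1) (x2, y2)) as [H|Hne]; [exact H|exfalso].
set (dx := (x2 - x1)%R). set (dy := (y2 - y1)%R).
assert (Hd : (0 < dx * dx + dy * dy)%R).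
{ destruct (Req_dec dx 0) as [Ex|Ex]; [destruct (Req_dec dy 0) as [Ey|Ey]|]; [|nra|nra].
  exfalso; apply Hne. unfold dx in Ex; unfold dy in Ey. f_equal; lra. }
set (gam := fun s => (x1 + s * dx, y1 + s * dy)%R : C).
assert (Hneg : forall s, (0 <= s <= 1)%R -> (Re (gam s) < 0)%R).
{ intros s Hs. unfold gam, dx; simpl. nra. }
set (phi := fun s => Re (Cconj (dx, dy) * F (gam s))).
assert (D : forall s, (0 <= s <= 1)%R -> is_derive phi s ((dx * dx + dy * dy) * Re (F' (gam s)))%R).
{ intros s Hs.
  destruct (cderiv_curve (fun z => Cconj (dx, dy) * F z) (fun s => x1 + s * dx)%R
    (fun s => y1 + s * dy)%R s dx dy
    (Cconj (dx, dy) * F' (gam s))) as [A _].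
  - auto_derive; [trivial|ring].
  - auto_derive; [trivial|ring].
  - apply cderiv_scal, HF, Hneg, Hs.
  - replace ((dx * dx + dy * dy) * Re (F' (gam s)))%R with (Re (Cconj (dx, dy) * F' (gam s) * (dx, dy))); [exact A|].
    destruct (F' (gam s)) as [u v]. simpl. ring. }
destruct (MVT_cor2 phi
  (fun s => (dx * dx + dy * dy) * Re (F' (gam s)))%R 0 1 Rlt_0_1) as [c [Ec Hc]].
- intros s Hs. apply is_derive_Reals, D, Hs.
- replace (phi 1%R) with (phi 0%R) in Ec.
  + assert (P := HF' _ (Hneg c ltac:(lra))).
    assert (0 < (dx * dx + dy * dy) * Re (F' (gam c)))%R by (apply Rmult_lt_0_compat; assumption).
    lra.
  + unfold phi. f_equal. f_equal.
    replace (gam 0%R) with ((x1, y1) : C) by (unfold gam; f_equal; ring).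
    replace (gam 1%R) with ((x2, y2) : C) by (unfold gam, dx, dy; f_equal; ring).
    exact E.
Qed.

(** In the coordinate z = exp(u), u + L(exp u) is a logarithm of the function and its
    derivative 1 + z L' has positive real part, so it is injective.  Two points with the
    same value have logarithms differing by some tau with exp(tau) = 1; moving one of
    the two preimages by tau removes the difference without changing its image under exp. *)
Lemma starlike_univalent (L L' : C -> C) :
  (forall z, unit_disk z -> cderiv L z (L' z)) ->
  (forall z, unit_disk z -> (0 < Re (1 + z * L' z))%R) ->
  univalent_on_disk (fun z => z * Cexp (L z)).
Proof.
intros HL HP z w Hz Hw E.
destruct (Ceq_dec z 0) as [->|Hz0]; [|destruct (Ceq_dec w 0) as [->|Hw0]].
- destruct (Ceq_dec w 0) as [->|Hw0]; [reflexivity|exfalso].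
  apply (Cmult_neq_0 _ _ Hw0 (Cexp_neq_0 (L w))). rewrite <- E. ring.
- exfalso. apply (Cmult_neq_0 _ _ Hz0 (Cexp_neq_0 (L z))). rewrite E. ring.
- assert (Hdisk : forall u, (Re u < 0)%R -> unit_disk (Cexp u)).
  { intros u Hu. unfold unit_disk. rewrite Cmod_Cexp, <- exp_0. now apply exp_increasing. }
  assert (Hln : forall z : C, z <> 0 -> unit_disk z -> (ln (Cmod z) < 0)%R).
  { intros v Hv0 Hv. rewrite <- ln_1. apply ln_increasing; [apply Cmod_gt_0, Hv0 | exact Hv]. }
  destruct (Cexp_surj z Hz0) as [u [Eu Ru]]. destruct (Cexp_surj w Hw0) as [v [Ev Rv]].
  assert (Hu : (Re u < 0)%R) by (rewrite Ru; apply Hln; assumption).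
  assert (Hv : (Re v < 0)%R) by (rewrite Rv; apply Hln; assumption).
  set (F := fun u => u + L (Cexp u)).
  (* F(v + tau) = F(v) + tau = F(u), as exp(v + tau) = exp(v). *)
  set (tau := F u - F v).
  assert (Etau : Cexp tau = 1).
  { assert (Q : Cexp tau * Cexp (F v) = Cexp (F v)).
    { rewrite <- Cexp_plus. replace (tau + F v) with (F u) by (unfold tau; ring).
      unfold F. rewrite !Cexp_plus, Eu, Ev. exact E. }
    replace (Cexp tau) with (Cexp tau * Cexp (F v) / Cexp (F v)) by (field; apply Cexp_neq_0).
    rewrite Q. field. apply Cexp_neq_0. }
  assert (Rtau : Re tau = 0%R).
  { apply (f_equal Cmod) in Etau. rewrite Cmod_Cexp, Cmod_1, <- exp_0 in Etau. now apply exp_inv. }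
  assert (Hsh : Cexp (v + tau) = w).
  { rewrite Cexp_plus, Etau, Ev. ring. }
  assert (K : u = v + tau).
  { apply (Noshiro_Warschawski_half_plane F (fun u => 1 + Cexp u * L' (Cexp u))).
    - intros t Ht. eapply cderiv_eq; [|exact (cderiv_plus _ _ t _ _ (cderiv_id t)
        (cderiv_comp L Cexp t _ _ (HL _ (Hdisk t Ht)) (cderiv_Cexp t)))]. simpl; ring.
    - intros t Ht. apply HP, Hdisk, Ht.
    - exact Hu.
    - rewrite re_plus, Rtau, Rplus_0_r. exact Hv.
    - unfold F at 2. rewrite Hsh, <- Ev.
      transitivity (F v + tau); [unfold tau; ring | unfold F; ring]. }
  rewrite <- Eu, <- Hsh. now rewrite K.
Qed.

(** * The extremal functions *)

Lemma Cmod_RtoC_inv_le_1 x : (1 <= x)%R -> (Cmod (RtoC (/ x)) <= 1)%R.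
Proof.
intros Hx. rewrite Cmod_R, Rabs_pos_eq by (left; apply Rinv_0_lt_compat; lra).
rewrite <- Rinv_1. apply Rinv_le_contravar; lra.
Qed.

Lemma INR_fact_ge_1 k : (1 <= INR (fact k))%R.
Proof. apply (le_INR 1). apply lt_O_fact. Qed.

(** The sum E of the series satisfies E' = E, so E(z) exp(-z) is constant. *)
Lemma Cexp_series : disk_series (fun k => RtoC (/ INR (fact k))) Cexp.
Proof.
set (c := fun k => RtoC (/ INR (fact k))).
assert (HE := disk_series_bounded_coeff c (fun k => Cmod_RtoC_inv_le_1 _ (INR_fact_ge_1 k))).
set (E := fun z => CSeries (fun k => c k * z ^ k)) in HE.
destruct (disk_series_derive c E HE) as [E' [HE' DE]].
assert (EE : forall z, unit_disk z -> E' z = E z).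
{ apply (disk_series_unique c); [|exact HE]. revert HE'. apply disk_series_ext. intros k.
  unfold Cderive_coeff, c. rewrite <- RtoC_mult. f_equal.
  rewrite fact_simpl, mult_INR. field. split; [apply INR_fact_neq_0 | apply not_0_INR; lia]. }
assert (K : forall z, unit_disk z -> E z * Cexp (- (1) * z) = E 0 * Cexp (- (1) * 0)).
{ apply (cderiv_0_disk_const (fun z => E z * Cexp (- (1) * z))). intros z Hz.
  eapply cderiv_eq; [|exact (cderiv_mult _ _ z _ _ (DE z Hz)
    (cderiv_comp Cexp _ z _ _ (cderiv_Cexp (- (1) * z)) (cderiv_scal (- (1)) _ z _ (cderiv_id z))))].
  simpl. rewrite EE by exact Hz. ring. }
intros z Hz. replace (Cexp z) with (E z); [exact (HE z Hz)|].
replace (Cexp z) with (E z * Cexp (- (1) * z) * Cexp z).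
- rewrite <- Cmult_assoc, <- Cexp_plus. replace (- (1) * z + z) with (RtoC 0) by ring.
  rewrite Cexp_0. ring.
- rewrite (K z Hz), (disk_series_0 c E HE). replace (- (1) * 0) with (RtoC 0) by ring.
  rewrite Cexp_0. unfold c. simpl. rewrite Rinv_1. ring.
Qed.

(** The coefficients of the integral of (exp(t) - 1)/t from 0 to u, which is - Ein(-u) for
    the entire exponential integral Ein. *)
Definition Ein_coeff (k : nat) : C :=
  match k with O => 0 | S _ => RtoC (/ (INR k * INR (fact k))) end.

Lemma Ein_ODE : exists K K', disk_series Ein_coeff K /\
  (forall u, unit_disk u -> cderiv K u (K' u)) /\
  forall u, unit_disk u -> u * K' u = Cexp u - 1.
Proof.
assert (HK : disk_series Ein_coeff (fun u => CSeries (fun k => Ein_coeff k * u ^ k))).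
{ apply disk_series_bounded_coeff. intros [|k].
  - simpl. rewrite Cmod_0. lra.
  - apply Cmod_RtoC_inv_le_1. assert (F := INR_fact_ge_1 (S k)).
    assert (1 <= INR (S k))%R by (apply (le_INR 1); lia). nra. }
destruct (disk_series_derive _ _ HK) as [K' [HK' DK]].
exists (fun u => CSeries (fun k => Ein_coeff k * u ^ k)), K'. repeat split; [exact HK | exact DK |].
intros u Hu.
assert (A := is_Cseries_scal u _ _ (HK' u Hu)).
assert (B := proj1 (is_Cseries_shift _ _) (Cexp_series u Hu)).
simpl in B. rewrite Rinv_1 in B. replace (Cexp u - 1 * 1) with (Cexp u - 1) in B by ring.
apply (is_Cseries_unique _ _ _ A). refine (is_Cseries_eq _ _ _ _ _ (eq_refl _) B).
intros k. unfold Cderive_coeff, Ein_coeff.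
replace (RtoC (INR (S k)) * RtoC (/ (INR (S k) * INR (fact (S k))))) with (RtoC (/ INR (fact (S k)))).
- simpl; ring.
- rewrite <- RtoC_mult. f_equal. field. split; [apply INR_fact_neq_0 | apply not_0_INR; lia].
Qed.

Lemma log_coeff_bound_attained n : (0 < n)%nat ->
  exists (f : C -> C) (gamma : nat -> C),
    class_S_e_star f /\ is_log_coeffs f gamma /\ Cmod (gamma n) = (1 / (2 * INR n))%R.
Proof.
intros Hn.
assert (HI : (0 < INR n)%R) by (apply lt_0_INR, Hn).
assert (HIC : RtoC (INR n) <> 0) by (intros H; apply RtoC_inj in H; lra).
destruct Ein_ODE as [K [K' [HK [DK EK]]]].
set (L := fun z => / INR n * K (z ^ n)).
set (L' := fun z => K' (z ^ n) * z ^ pred n).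
set (f := fun z => z * Cexp (L z)).
set (gamma := gap n (fun j => / (2 * INR n) * Ein_coeff j)).
assert (Hpow : forall z, unit_disk z -> unit_disk (z ^ n)) by (intros z; apply unit_disk_pow, Hn).
assert (DL : forall z, unit_disk z -> cderiv L z (L' z)).
{ intros z Hz. unfold L, L'.
  eapply cderiv_eq;
    [|exact (cderiv_scal (/ INR n) _ z _ (cderiv_comp K _ z _ _ (DK _ (Hpow z Hz)) (cderiv_pow n z)))].
  field. exact HIC. }
assert (EL : forall z, unit_disk z -> 1 + z * L' z = Cexp (z ^ n)).
{ intros z Hz. unfold L'.
  replace (z * (K' (z ^ n) * z ^ pred n)) with (z ^ n * K' (z ^ n)).
  - rewrite (EK _ (Hpow z Hz)). ring.
  - destruct n as [|m]; [lia|]. simpl. ring. }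
assert (H0n : 0 ^ n = 0).
{ destruct n as [|m]; [lia|]. simpl. ring. }
assert (HL0 : L 0 = 0).
{ unfold L. rewrite H0n, (disk_series_0 _ _ HK). simpl. ring. }
assert (Df : forall z, unit_disk z -> cderiv f z (Cexp (L z) * (1 + z * L' z))).
{ intros z Hz. apply cderiv_id_Cexp, DL, Hz. }
exists f, gamma. split; [|split].
- split; [repeat split|].
  + intros z Hz. eexists. apply cderiv_is_derive, Df, Hz.
  + apply (starlike_univalent L L' DL). intros z Hz. rewrite EL by exact Hz.
    apply Cexp_disk_Re_pos, Hpow, Hz.
  + unfold f. ring.
  + rewrite (cderiv_unique _ _ _ (Df 0 unit_disk_0)), HL0, Cexp_0. ring.
  + exists (fun z => z ^ n). repeat split.
    * intros z Hz. eexists. apply cderiv_is_derive, cderiv_pow.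
    * exact Hpow.
    * exact H0n.
    * intros z Hz. rewrite <- EL by exact Hz.
      apply (zderiv_quot_id_Cexp f L); [reflexivity | exact Hz | apply DL, Hz].
- exists L. split; [repeat split|].
  + intros z Hz. eexists. apply cderiv_is_derive, DL, Hz.
  + exact HL0.
  + intros z Hz. unfold quot_id. destruct (Ceq_dec z 0) as [->|Hz0].
    * rewrite HL0. apply Cexp_0.
    * unfold f. field. exact Hz0.
  + intros z Hz. exists (/ 2 * L z). split; [|field; intros H; apply RtoC_inj in H; lra].
    assert (S0 := is_Cseries_gap n _ _ Hn (is_Cseries_scal (/ (2 * INR n)) _ _ (HK _ (Hpow z Hz)))).
    apply is_Cseries_shift in S0.
    refine (is_Cseries_eq _ _ _ _ _ _ S0).
    * intros k. unfold gamma. rewrite <- gap_pow by exact Hn. unfold gap.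
      destruct (S k mod n =? 0)%nat; ring.
    * unfold gap, L. rewrite Nat.Div0.mod_0_l, Nat.Div0.div_0_l. simpl.
      field. exact HIC.
- unfold gamma, gap. rewrite Nat.Div0.mod_same, Nat.div_same by lia. simpl.
  rewrite !Rmult_1_l, Rinv_1, Cmult_1_r, <- RtoC_mult, <- RtoC_inv by lra.
  rewrite Cmod_R, Rabs_pos_eq; [field; lra | left; apply Rinv_0_lt_compat; lra].
Qed.

Local Close Scope C_scope.

(** * Sharp bounds for the first four logarithmic coefficients *)

Theorem theorem3p1 :
  (forall (f : C -> C) (gamma : nat -> C),
     class_S_e_star f -> is_log_coeffs f gamma ->
     forall n : nat, (1 <= n <= 4)%nat ->
       (Cmod (gamma n) <= 1 / (2 * INR n))%R)
  /\
  (forall n : nat, (1 <= n <= 4)%nat ->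
     exists (f : C -> C) (gamma : nat -> C),
       class_S_e_star f /\ is_log_coeffs f gamma /\
       Cmod (gamma n) = (1 / (2 * INR n))%R).
Proof.
split.
- intros f gamma Hf Hg n Hn. apply (log_coeff_bound f); [exact Hf | exact Hg | lia].
- intros n Hn. apply log_coeff_bound_attained. lia.
Qed.
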